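(* Let $\mathfrak g$ be a semisimple complex Lie algebra, let $\theta\in\operatorname{Aut}\mathfrak g$ be an element of order $2$ with $\mathfrak k=\{x\in\mathfrak g\mid\theta(x)=x\}$ and $\mathfrak p=\{x\in\mathfrak g\mid\theta(x)=-x\}$. Let $e\in\mathcal N(\mathfrak p)_{\rm pr}$ be a principal nilpotent element of $\mathfrak p$, included in an $\mathfrak{sl}_2$-triple $\{e,h,f\}$ in $\mathfrak g$ such that $h\in\mathfrak k$ and $e,f\in\mathfrak p$. For $d\in\mathbb Z$ let $\mathfrak g_d=\{x\in\mathfrak g\mid[h,x]=dx\}$, and put $\mathfrak l=\mathfrak g_0$, $\mathfrak u=\bigoplus_{d>0}\mathfrak g_d$. Then $$\dim\mathfrak l^-=\dim\,\mathfrak u^+/[\mathfrak u,\mathfrak u]^+ .$$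
   Context: For a subset $\mathfrak x\subseteq\mathfrak g$, $\mathfrak x^+=\mathfrak x\cap\mathfrak k$ and $\mathfrak x^-=\mathfrak x\cap\mathfrak p$. $G$ is the adjoint group of $\mathfrak g$, and $K$ is the connected (reductive algebraic) subgroup of $G$ with Lie algebra $\mathfrak k$; it acts on $\mathfrak p$ by the adjoint action. $\mathcal N(\mathfrak p)$ is the Zariski closed set of all elements $x\in\mathfrak p$ with $\operatorname{ad}x$ nilpotent on $\mathfrak g$. There are only finitely many $K$-orbits in $\mathcal N(\mathfrak p)$, so every irreducible component of $\mathcal N(\mathfrak p)$ contains an open $K$-orbit; $\mathcal N(\mathfrak p)_{\rm pr}$ is the union of these open orbits, and its elements are the principal nilpotent elements of $\mathfrak p$. An $\mathfrak{sl}_2$-triple is an ordered triple $\{e,h,f\}$ of elements of $\mathfrak g$ with $[h,e]=2e$, $[h,f]=-2f$, $[e,f]=h$. Every nonzero $e\in\mathcal N(\mathfrak p)$ can be included in an $\mathfrak{sl}_2$-triple with $h\in\mathfrak k$, $e,f\in\mathfrak p$. *)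

(* Defs.v *)
From HB Require Import structures.
From mathcomp Require Import all_boot all_order all_algebra.
From mathcomp Require Import classical_sets reals complex mpoly.

Set Implicit Arguments.
Unset Strict Implicit.
Unset Printing Implicit Defensive.

Import GRing.Theory.
Local Open Scope ring_scope.
Local Open Scope classical_set_scope.

Section Zariski.
Variables (F : fieldType) (W : vectType F).

(* A polynomial function on W is a polynomial in the coordinates with respect
   to the basis [vbasis {:W}]; the resulting class of functions, hence every
   notion of this section, does not depend on that basis. *)
Definition poly_eval (q : {mpoly F[\dim {:W}]}) (w : W) : F :=
  q.@[fun i => coord (vbasis {:W}) i w].

Definition zariski_closed (Z : set W) : Prop :=
  exists S : set {mpoly F[\dim {:W}]},
    Z = [set w | forall q, S q -> poly_eval q w = 0].

Definition zariski_closed_in (A Z : set W) : Prop :=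
  exists2 Y, zariski_closed Y & Z = A `&` Y.

Definition zariski_open_in (A O : set W) : Prop :=
  exists2 Y, zariski_closed Y & O = A `\` Y.

Definition zariski_connected (A : set W) : Prop :=
  forall Y1 Y2, zariski_closed_in A Y1 -> zariski_closed_in A Y2 ->
    A = Y1 `|` Y2 -> Y1 `&` Y2 = set0 -> Y1 = set0 \/ Y2 = set0.

Definition zariski_component (A : set W) (a : W) : set W :=
  [set b | exists C : set W,
     [/\ C `<=` A, zariski_connected C, C a & C b]].

(* Zariski tangent space at a: the differential at a of every polynomial
   function vanishing on A (not merely of some equations cutting out A)
   vanishes on w. *)
Definition zariski_tangent (A : set W) (a : W) : set W :=
  [set w | forall q, (forall b, A b -> poly_eval q b = 0) ->
     \sum_i poly_eval (mderiv i q) a * coord (vbasis {:W}) i w = 0].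

End Zariski.

Section LinearAlgebraicGroups.
Variables (F : fieldType) (V : vectType F).

Definition GL : set 'End(V) := [set a | lker a == 0%VS].

Definition algebraic_subgroup (H : set 'End(V)) : Prop :=
  [/\ H `<=` GL, zariski_closed_in GL H, H \1%VF,
      forall a b, H a -> H b -> H (a \o b)%VF
    & forall a, H a -> H (a^-1)%VF].

Definition group_orbit (H : set 'End(V)) (x : V) : set V :=
  [set a x | a in H].

End LinearAlgebraicGroups.

Record lie_bracket (F : fieldType) (V : vectType F) := LieBracket {
  bracket :> V -> V -> V;
  bracket_linearr : forall x, linear (bracket x);
  bracket_linearl : forall y, linear (bracket^~ y);
  bracketxx : forall x, bracket x x = 0;
  bracket_jacobi : forall x y z,
    bracket x (bracket y z) + bracket y (bracket z x)
      + bracket z (bracket x y) = 0 }.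

Section LieAlgebras.
Variables (F : fieldType) (V : vectType F) (br : lie_bracket V).

Definition ad (x : V) : 'End(V) := linfun (br x).

Lemma adE x y : ad x y = br x y.
Proof.
pose L := GRing.isLinear.Build F V V *:%R (br x) (bracket_linearr br x).
by rewrite (lfunE (HB.pack_for {linear V -> V} (bracket br x) L)).
Qed.

Definition ad_nilpotent (x : V) : Prop := exists n, forall y, iter n (br x) y = 0.

(* [U, W]: the span of all brackets; see lie_prodP. *)
Definition lie_prod (U W : {vspace V}) : {vspace V} :=
  <<[seq br x y | x <- vbasis U, y <- vbasis W]>>%VS.

Lemma lie_prodP (U W Z : {vspace V}) :
  (forall x y, x \in U -> y \in W -> br x y \in Z) <-> (lie_prod U W <= Z)%VS.
Proof.
split=> [UWZ | /span_subvP sZ x y Ux Wy].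
  apply/span_subvP=> _ /allpairsP[[x y] /= [xU yW ->]].
  by apply: UWZ; apply: vbasis_mem.
have brl (y0 : V) : exists f : {linear V -> V}, forall x, f x = br x y0.
  pose L := GRing.isLinear.Build F V V *:%R _ (bracket_linearl br y0).
  by exists (HB.pack_for {linear V -> V} (fun x0 => bracket br x0 y0) L).
rewrite (coord_vbasis Wy) -adE linear_sum; apply: memv_suml => j _.
rewrite linearZ /= adE memvZ //; have [f fE] := brl (vbasis W)`_j.
rewrite -fE (coord_vbasis Ux) linear_sum; apply: memv_suml => i _.
rewrite linearZ /= fE memvZ //; apply: sZ; apply/allpairsP.
by exists ((vbasis U)`_i, (vbasis W)`_j); split=> //=;
  apply: mem_nth; rewrite size_tuple.
Qed.

Definition lie_ideal (I : {vspace V}) : Prop :=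
  forall x y, y \in I -> br x y \in I.

Definition lie_solvable (U : {vspace V}) : Prop :=
  exists n, iter n (fun D => lie_prod D D) U = 0%VS.

Definition semisimple : Prop :=
  forall I : {vspace V}, lie_ideal I -> lie_solvable I -> I = 0%VS.

Definition lie_aut : set 'End(V) :=
  [set a | GL a /\ forall x y, a (br x y) = br (a x) (a y)].

(* The adjoint group of a semisimple Lie algebra is the identity component of
   its automorphism group. *)
Definition adjoint_group : set 'End(V) := zariski_component lie_aut \1%VF.

(* H has Lie algebra ad m, the subspace m being identified with its image
   under ad. *)
Definition has_lie_algebra (H : set 'End(V)) (m : {vspace V}) : Prop :=
  zariski_tangent H \1%VF = [set ad x | x in [set` m]].

Definition connected_subgroup_with_lie_algebra
    (m : {vspace V}) (H : set 'End(V)) : Prop :=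
  [/\ H `<=` adjoint_group, algebraic_subgroup H, zariski_connected H
    & has_lie_algebra H m].

Definition sl2_triple (e h f : V) : Prop :=
  [/\ br h e = 2%:R *: e, br h f = - (2%:R *: f) & br e f = h].

Definition weight_space (h : V) (d : int) : {vspace V} :=
  passmx.leigenspace (ad h) d%:~R.

(* U is the sum of the g_d over the infinite index set d > 0, i.e. the least
   subspace containing them all; the sum is automatically direct. *)
Definition is_positive_part (h : V) (U : {vspace V}) : Prop :=
  (forall d : int, 0 < d -> (weight_space h d <= U)%VS) /\
  (forall U' : {vspace V},
     (forall d : int, 0 < d -> (weight_space h d <= U')%VS) -> (U <= U')%VS).

End LieAlgebras.

Section Involution.
Variables (F : fieldType) (V : vectType F) (br : lie_bracket V).
Variable theta : 'End(V).

Definition lie_involution : Prop :=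
  [/\ lie_aut br theta, (theta \o theta)%VF = \1%VF & theta <> \1%VF].

Definition even_space : {vspace V} := passmx.leigenspace theta 1.
Definition odd_space : {vspace V} := passmx.leigenspace theta (-1).

Definition plus_part (U : {vspace V}) : {vspace V} := (U :&: even_space)%VS.
Definition minus_part (U : {vspace V}) : {vspace V} := (U :&: odd_space)%VS.

Definition nilcone : set V := [set x | x \in odd_space /\ ad_nilpotent br x].

(* Every open K-orbit lies in an irreducible component of the nilcone, so the
   union of the open orbits contained in the components is the union of all
   open orbits. *)
Definition principal_nilpotents (K : set 'End(V)) : set V :=
  \bigcup_(O in [set O | (exists2 x, nilcone x & O = group_orbit K x) /\
                         zariski_open_in nilcone O]) O.

End Involution.

(* dim U/W, for W contained in U: [U :\: W] is a complement of [U :&: W] in U. *)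
Definition dim_quotient (F : fieldType) (V : vectType F) (U W : {vspace V}) :
  nat := \dim (U :\: W).

(* Main.v *)
Require Import Defs.
From HB Require Import structures.
From mathcomp Require Import all_boot all_order all_algebra.
From mathcomp Require Import boolp classical_sets functions cardinality reals complex mpoly.
From mathcomp Require Import ring zify lra.

Set Implicit Arguments.
Unset Strict Implicit.
Unset Printing Implicit Defensive.

Import Order.TTheory GRing.Theory Num.Theory.
Import VectorInternalTheory.
Local Open Scope ring_scope.

(* A nilpotent element of the slice S = e + p^f, once contracted towards e by the
   torus attached to h, lies in the open K-orbit, hence is conjugate to e by an
   automorphism of g; as [e, g] and g^f are complementary, it follows that e is
   the only nilpotent element of S.  So the restrictions to S of the functions
   x |-> tr (ad x)^i, which are weighted homogeneous, vanish simultaneously at e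
   only; by the Nullstellensatz, the coordinates of S are then integral over
   these functions, and a derivation that kills the functions is 0.  If
   dim [k, x] > dim [k, e] for some x in S, a dimension count over the field of
   rational functions on S yields a nonzero such derivation, directed along the
   K-orbits; so dim [g, x] <= dim [g, e] for all x in S.  Applied to the lines
   e + t s, for s in p centralized by e and h, and to e + t f, this shows that
   s = 0 and that ad h has only even eigenvalues.  Therefore u is the direct sum
   of g_2 and [u, u], and ad e maps l^- isomorphically onto g_2^+. *)

(** * Nilpotent matrices and conjugate eigenvalues *)

(** The traces of powers of ad x replace generators of the K-invariants on p: they detect
    nilpotency, have zero derivative along orbits, and are weighted homogeneous on S. The count is
    made with [k, x] because it stays inside p, where S has dimension at least dim p - dim [k, e];
    Killing duality gives dim [g, x] = 2 dim [k, x] for x in p, which carries the bound over to g,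
    where the lines e + t s are studied. On such a line one looks for a summand W1 of g, stable
    under ad e and ad s, on which ad (e + s) is injective. If W1 is nonzero, the nilpotent ad e has
    a kernel in it, so a suitable t gives a larger rank than at e: hence W1 = 0. For s commuting
    with e, W1 is the Fitting component where ad s is invertible; its vanishing makes s, hence e +
    s, nilpotent, and e + s lies in S. For s = f, W1 is the span of the odd weights, where e + f,
    which behaves like h in another triple, has no kernel. The facts on sl_2 come from the Casimir
    operator, without complete reducibility. The Nullstellensatz rests on the uncountability of the
    complex numbers. *)

Section MatrixTrace.
Variable F : fieldType.

(** For a full rank factorization E = C R, idempotence cancels down to R C = 1, and tr (C R) = tr (R
    C). *)
Lemma mxtrace_idem n (E : 'M[F]_n) : E *m E = E -> \tr E = (\rank E)%:R.
Proof.
move=> EE; have E1 : row_base E *m col_base E = 1%:M.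
  have cbT : row_free (col_base E)^T by rewrite /row_free mxrank_tr; exact: col_base_full.
  apply: (row_free_inj (row_base_free E)); rewrite mul1mx.
  apply: trmx_inj; apply: (row_free_inj cbT).
  rewrite -!trmx_mul; congr trmx; rewrite -(mulmxA (row_base E)) mulmx_base (mulmxA (col_base E)).
  by rewrite mulmx_base.
by rewrite -[in LHS](mulmx_base E) mxtrace_mulC E1 mxtrace1.
Qed.

End MatrixTrace.

Section NilpotentMatrix.
Variable F : numClosedFieldType.

Lemma horner_mxE n (A : 'M[F]_n.+1) (p : {poly F}) :
  horner_mx A p = \sum_(i < size p) p`_i *: A ^+ i.
Proof.
rewrite -{1}[p]coefK poly_def rmorph_sum /=; apply: eq_bigr => i _.
by rewrite linearZ /= rmorphXn /= horner_mx_X.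
Qed.

(* If A is not nilpotent, some polynomial in A without constant term is a
   nonzero idempotent, whose trace is its rank. *)
Lemma mx_nilpotent_trace n (A : 'M[F]_n) :
  (forall k, (k < n)%N -> \tr (A ^+ k.+1) = 0) -> exists m, A ^+ m = 0.
Proof.
case: n A => [|n] A trA; first by exists 0%N; apply: thinmx0.
(* Reducing modulo ['X * c] instead of [c] preserves the zero constant term, so only the powers 1 to
   [n.+1] of A survive. *)
have trp (p : {poly F}) : p`_0 = 0 -> \tr (horner_mx A p) = 0.
  move=> p0; set c := char_poly A.
  have c0 : 'X * c != 0 by rewrite mulf_neq0 ?polyX_eq0 ?monic_neq0 ?char_poly_monic.
  have -> : horner_mx A p = horner_mx A (p %% ('X * c)).
    rewrite {1}(divp_eq p ('X * c)) rmorphD !rmorphM /= Cayley_Hamilton.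
    by rewrite !mulr0 add0r.
  set r := p %% _; have r0 : r`_0 = 0.
    have := congr1 (fun q : {poly F} => q`_0) (divp_eq p ('X * c)).
    by rewrite p0 coefD mulrCA coefXM /= add0r.
  have szr : (size r <= n.+2)%N.
    rewrite -ltnS; have := ltn_modpN0 p c0.
    by rewrite size_mul ?polyX_eq0 ?monic_neq0 ?char_poly_monic // size_polyX size_char_poly.
  rewrite horner_mxE raddf_sum big1 // => -[[|i] /= ir] _.
    by rewrite r0 scale0r mxtrace0.
  by rewrite mxtraceZ trA ?mulr0 // -ltnS (leq_trans ir).
have [k [q [q0 cE]]] := multiplicity_XsubC (char_poly A) 0.
rewrite subr0 in cE.
(* The exponent is [k.+1], not [k], so that [E] has no constant term even when 0 is not an
   eigenvalue. *)
have q00 : coprimep 'X^(k.+1) q.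
  apply: coprimep_expl; rewrite coprimep_sym -['X]subr0 coprimep_XsubC.
  by have := q0; rewrite monic_neq0 ?char_poly_monic //.
have /Bezout_eq1_coprimepP[[u v] /= uv] := q00.
pose E := horner_mx A (u * 'X^(k.+1)).
have vq : horner_mx A (v * q) = 1 - E.
  by apply: (canRL (addrK _)); rewrite -rmorphD addrC uv rmorph1.
have AkE : A ^+ k *m (1 - E) = 0.
  have /(congr1 (horner_mx A)) : 'X^k * (v * q) = v * char_poly A by rewrite cE; ring.
  by rewrite [LHS]rmorphM rmorphXn /= horner_mx_X vq [RHS]rmorphM /= Cayley_Hamilton mulr0.
have E0 : E = 0.
  apply/eqP; rewrite -mxrank_eq0 -(pnatr_eq0 F) -mxtrace_idem ?trp ?eqxx //.
    by rewrite exprSr mulrA coefMX.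
  apply/eqP; rewrite -subr_eq0 -[X in _ - X]mulmx1 -mulmxBr.
  rewrite -opprB mulmxN oppr_eq0.
  have EE : E = horner_mx A (u * 'X) *m A ^+ k.
    rewrite -{2}(horner_mx_X A) -rmorphXn -[RHS](rmorphM (horner_mx A)) /=.
    by congr horner_mx; rewrite exprS mulrA.
  by rewrite {1}EE -mulmxA; apply/eqP; rewrite -[RHS](mulmx0 _ (horner_mx A (u * 'X))) -AkE.
by exists k; have := AkE; rewrite E0 subr0 mulmx1.
Qed.

Lemma mxtrace_nilpotent n (A : 'M[F]_n) m : A ^+ m = 0 -> \tr A = 0.
Proof.
case: n A => [|n] A Am; first by rewrite [A]thinmx0 mxtrace0.
have [r cE] := closed_field_poly_normal (char_poly A).
rewrite (monicP (char_poly_monic A)) scale1r in cE.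
have r0 x : x \in r -> x = 0.
  move=> xr; have : root (char_poly A) x by rewrite cE root_prod_XsubC.
  rewrite -eigenvalue_root_char => /eigenvalueP[v vA v0].
  have : v *m A ^+ m = x ^+ m *: v.
    elim: m {Am} => [|m IH]; first by rewrite mulmx1 scale1r.
    by rewrite exprSr [_ * A]/GRing.mul /= mulmxA IH -scalemxAl vA scalerA exprSr.
  rewrite Am mulmx0 => /esym/eqP; rewrite scaler_eq0 (negPf v0) orbF.
  by rewrite expf_eq0 => /andP[_ /eqP].
have cX : char_poly A = 'X^(n.+1).
  have : size (char_poly A) = n.+2 by rewrite size_char_poly.
  rewrite cE size_prod_XsubC => -[szr]; rewrite -szr.
  rewrite (eq_big_seq (fun=> 'X)) ?big_const_seq ?count_predT ?iter_mulr_1 //.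
  by move=> x /r0->; rewrite subr0.
have := @char_poly_trace _ _ A (ltn0Sn n); rewrite cX coefXn /=.
by rewrite ltn_eqF // => /esym/eqP; rewrite oppr_eq0 => /eqP.
Qed.

End NilpotentMatrix.

Section ConjugateEigenvalues.
Variable F : numClosedFieldType.

Lemma coprimep_prod_XsubC (s : seq F) (m : F -> nat) k a : a \notin s ->
  coprimep (('X - a%:P) ^+ k) (\prod_(b <- s) ('X - b%:P) ^+ m b).
Proof.
move=> as_; apply: coprimep_expl; rewrite coprimep_sym coprimep_XsubC /root.
rewrite horner_prod prodf_seq_neq0; apply/allP => b bs /=.
rewrite horner_exp hornerXsubC expf_neq0 // subr_eq0.
by apply: contraNneq as_ => ->.
Qed.

Lemma poly_chinese (s : seq F) (m : F -> nat) (c : F -> F) : uniq s ->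
  exists p, forall a, a \in s -> ('X - a%:P) ^+ m a %| p - (c a)%:P.
Proof.
elim: s => [|a s IH] /=; first by exists 0.
case/andP=> as_ /IH[p pP]; set q := \prod_(b <- s) ('X - b%:P) ^+ m b.
have /Bezout_eq1_coprimepP[[u w] /= uw] := coprimep_prod_XsubC m (m a) as_.
exists (p + ((c a)%:P - p) * (w * q)) => b; rewrite inE => /predU1P[->|bs].
  have -> : p + ((c a)%:P - p) * (w * q) - (c a)%:P =
      (p - (c a)%:P) * u * ('X - a%:P) ^+ m a.
    have -> : w * q = 1 - u * ('X - a%:P) ^+ m a.
      by apply: (canRL (addrK _)); rewrite addrC.
    ring.
  exact: dvdp_mull.
have -> : p + ((c a)%:P - p) * (w * q) - (c b)%:P =
  (p - (c b)%:P) + ((c a)%:P - p) * w * q by ring.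
rewrite dvdp_add ?pP // dvdp_mull // /q (big_rem b) //=; exact: dvdp_mulr.
Qed.

Definition gen_eigenvector n (A : 'M[F]_n) a (v : 'rV_n) :=
  exists k, v *m (A - a%:M) ^+ k = 0.

Lemma sum_gen_eigenvectors n (A : 'M[F]_n.+1) v : exists2 r : seq (F * 'rV_n.+1),
  v = \sum_(x <- r) x.2 & forall x, x \in r -> gen_eigenvector A x.1 x.2.
Proof.
have [r cE] := closed_field_poly_normal (char_poly A).
rewrite (monicP (char_poly_monic A)) scale1r in cE.
suff H (m : F -> nat) (s : seq F) w : uniq s ->
    w *m horner_mx A (\prod_(b <- s) ('X - b%:P) ^+ m b) = 0 ->
    exists2 t : seq (F * 'rV_n.+1),
      w = \sum_(x <- t) x.2 & forall x, x \in t -> gen_eigenvector A x.1 x.2.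
  apply: (H (fun b => count_mem b r) (undup r)); first exact: undup_uniq.
  by rewrite prodr_undup_exp_count -cE Cayley_Hamilton mulmx0.
elim: s w => {cE r v} [|a s IH] v /=.
  by rewrite big_nil rmorph1 mulmx1 => _ ->; exists [::]; rewrite ?big_nil.
case/andP=> as_ us; rewrite big_cons; set q := \prod_(b <- s) _ => vc.
have /Bezout_eq1_coprimepP[[u w] /= uw] := coprimep_prod_XsubC m (m a) as_.
have [] := IH (v *m horner_mx A (u * ('X - a%:P) ^+ m a)) us.
  rewrite -mulmxA -[X in _ *m X](rmorphM (horner_mx A)) -mulrA [u * _]mulrC.
  by rewrite rmorphM /= [_ * _]/GRing.mul /= mulmxA vc mul0mx.
move=> r rE rP; exists ((a, v *m horner_mx A (w * q)) :: r).
  by rewrite big_cons -rE -mulmxDr -rmorphD addrC uw rmorph1 mulmx1.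
move=> x; rewrite inE => /predU1P[->|/rP//]; exists (m a) => /=.
have -> : (A - a%:M) ^+ m a = horner_mx A (('X - a%:P) ^+ m a).
  by rewrite rmorphXn rmorphB /= horner_mx_X horner_mx_C.
rewrite -mulmxA -[X in _ *m X](rmorphM (horner_mx A)).
have -> : w * q * ('X - a%:P) ^+ m a = (('X - a%:P) ^+ m a * q) * w by ring.
by rewrite rmorphM /= [_ * _]/GRing.mul /= mulmxA vc mul0mx.
Qed.

Lemma trig_horner_mx n (T : 'M[F]_n.+1) p : is_trig_mx T ->
  is_trig_mx (horner_mx T p) /\ forall i, horner_mx T p i i = p.[T i i].
Proof.
move=> /is_trig_mxP Tt; elim/poly_ind: p => [|p c [/is_trig_mxP pt pd]].
  by rewrite rmorph0 mx0_is_trig; split=> // i; rewrite mxE horner0.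
rewrite rmorphD rmorphM /= horner_mx_X horner_mx_C; split=> [|i].
  apply/is_trig_mxP => i j ij; rewrite !mxE (_ : (i == j) = false) ?mulr0n ?addr0.
    apply: big1 => k _; have [/pt->|ki] := ltnP i k; first by rewrite mul0r.
    by rewrite Tt ?mulr0 // (leq_ltn_trans ki).
  by apply: contraTF ij => /eqP->; rewrite ltnn.
rewrite !mxE eqxx mulr1n hornerMXaddC (bigD1 i) //= big1 ?addr0 ?pd // => k.
rewrite neq_ltn => /orP[ki|ik]; first by rewrite [X in _ * X]Tt ?mulr0.
by rewrite pt ?mul0r.
Qed.

(** S = p(A), where the Chinese remainder theorem makes p congruent to the conjugate of a modulo (X
    - a)^m for each eigenvalue a of multiplicity m. In a triangular form of A, tr (A S) is the sum
    of the |a|^2, so it vanishes only if every eigenvalue does. *)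
Lemma mx_conj_semisimple n (A : 'M[F]_n) : exists S : 'M[F]_n,
  (forall a v, gen_eigenvector A a v -> v *m S = a^* *: v) /\
  (\tr (A *m S) = 0 -> exists m, A ^+ m = 0).
Proof.
case: n A => [|n] A.
  exists 0; split=> [a v _|_]; last by exists 0%N; apply: thinmx0.
  by rewrite [v]thinmx0 mul0mx scaler0.
have [r cE] := closed_field_poly_normal (char_poly A).
rewrite (monicP (char_poly_monic A)) scale1r in cE.
have [p pP] := @poly_chinese (undup r) (fun b => count_mem b r) Num.conj (undup_uniq r).
exists (horner_mx A p); split=> [a v [k vk]|].
  pose q := \prod_(b <- rem a (undup r)) ('X - b%:P) ^+ count_mem b r.
  have aq : a \notin rem a (undup r) by rewrite mem_rem_uniqF ?undup_uniq.
  have cq : char_poly A = ('X - a%:P) ^+ count_mem a r * q.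
    rewrite cE -prodr_undup_exp_count.
    have [ar|ar] := boolP (a \in undup r); first by rewrite (big_rem a).
    by rewrite /q rem_id // (count_memPn _) ?expr0 ?mul1r // -mem_undup.
  have hA j : horner_mx A (('X - a%:P) ^+ j) = (A - a%:M) ^+ j.
    by rewrite rmorphXn rmorphB /= horner_mx_X horner_mx_C.
  have /Bezout_eq1_coprimepP[[u w] /= uw] := coprimep_prod_XsubC (fun b => count_mem b r) k aq.
  (* The exponent [k] is arbitrary; a Bezout combination with the characteristic polynomial lowers
     it to the multiplicity of a, which is 0 (so v = 0) if a is not an eigenvalue. *)
  have vm : v *m horner_mx A (('X - a%:P) ^+ count_mem a r) = 0.
    have -> : ('X - a%:P) ^+ count_mem a r =
        ('X - a%:P) ^+ k * (('X - a%:P) ^+ count_mem a r * u) + char_poly A * w.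
      by rewrite cq -[LHS]mulr1 -uw /q; ring.
    rewrite rmorphD !rmorphM /= Cayley_Hamilton mul0r addr0 hA.
    by rewrite [_ * _]/GRing.mul /= mulmxA vk mul0mx.
  have [ar|ar] := boolP (a \in undup r).
    have /dvdpP[t tE] := pP _ ar.
    have -> : p = ('X - a%:P) ^+ count_mem a r * t + (a^*)%:P.
      by rewrite mulrC -tE subrK.
    rewrite rmorphD rmorphM /= horner_mx_C mulmxDr mul_mx_scalar.
    by rewrite [_ * _]/GRing.mul /= mulmxA vm mul0mx add0r.
  have m0 : count_mem a r = 0%N by apply/count_memPn; rewrite -mem_undup.
  by move: vm; rewrite m0 expr0 rmorph1 mulmx1 => ->; rewrite mul0mx scaler0.
have [P Pu Tt] := @Schur _ _ A (ltn0Sn n).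
have {Pu}Pu := unitarymx_unit Pu.
have [T {}Tt AT] : exists2 T, is_trig_mx T & A = invmx P *m T *m P.
  by exists (conjmx P A); rewrite // -conjVmx // conjmxK.
have hT q : horner_mx A q = invmx P *m horner_mx T q *m P.
  by rewrite AT horner_mx_uconjC.
have rT x : root (char_poly A) x = root (char_poly T) x.
  have mE : mxminpoly A = mxminpoly T.
    rewrite AT -(conjVmx T Pu).
    have iP : invmx P \in unitmx by rewrite unitmx_inv.
    exact: mxminpoly_uconj.
  have rA := root_mxminpoly A x.
  have rT := root_mxminpoly T x.
  by rewrite -rA -rT mE.
move=> trS; have sum0 : \sum_i `|T i i| ^+ 2 = 0.
  have [/is_trig_mxP pt pd] := trig_horner_mx p Tt.
  rewrite -[RHS]trS hT {1}AT !mulmxA mulmxK // mxtrace_mulC.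
  rewrite !mulmxA mulmxV // mul1mx; apply: eq_bigr => i _.
  rewrite mxE (bigD1 i) //= big1 ?addr0 => [|k].
    rewrite normCK pd; congr (_ * _).
    have Tr : T i i \in undup r.
      rewrite mem_undup -root_prod_XsubC -cE rT char_poly_trig // /root horner_prod.
      by rewrite (bigD1 i) //= hornerXsubC subrr mul0r.
    have /dvdpP[t tE] := pP _ Tr.
    rewrite -[p](subrK (T i i)^*%:P) tE hornerD hornerC hornerM horner_exp.
    have m0 : (count_mem (T i i) r > 0)%N by rewrite -has_count has_pred1 -mem_undup.
    by rewrite hornerXsubC subrr expr0n eqn0Ngt m0 mulr0 add0r.
  rewrite neq_ltn => /orP[ki|ik]; first by rewrite [X in _ * X]pt ?mulr0.
  by move/is_trig_mxP: Tt => ->; rewrite ?mul0r.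
exists n.+1; have T0 i : T i i = 0.
  apply/eqP; rewrite -normr_eq0 -sqrf_eq0; apply/eqP.
  by apply: (psumr_eq0P _ sum0) => // j _; rewrite exprn_ge0.
have := Cayley_Hamilton T; rewrite char_poly_trig // (eq_bigr (fun=> 'X)); last first.
  by move=> i _; rewrite T0 subr0.
rewrite prodr_const card_ord => TX.
have := hT ('X^(n.+1)); rewrite TX mulmx0 mul0mx rmorphXn /= horner_mx_X.
by [].
Qed.

End ConjugateEigenvalues.

(** * Lie algebras and the Killing form *)

HB.instance Definition _ (F : fieldType) (V : vectType F) (br : lie_bracket V)
    (x : V) :=
  GRing.isLinear.Build F V V *:%R (bracket br x) (bracket_linearr br x).

Section LinearFunctions.
Variables (F : fieldType) (V : vectType F).
Implicit Types (f g : 'End(V)) (U : {vspace V}).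

Lemma v2r_lfun f v : v2r (f v) = v2r v *m f2mx f.
Proof. by rewrite unlock /= r2vK. Qed.

Lemma f2mxP f A : (forall v, v2r (f v) = v2r v *m A) -> f2mx f = A.
Proof.
move=> fA; apply/row_matrixP => i; rewrite !rowE -(r2vK (delta_mx 0 i)).
by rewrite -v2r_lfun fA.
Qed.

Lemma f2mx_comp f g : f2mx (f \o g)%VF = f2mx g *m f2mx f.
Proof. by apply: f2mxP => v; rewrite comp_lfunE !v2r_lfun mulmxA. Qed.

Lemma f2mx1 : f2mx (\1%VF : 'End(V)) = 1%:M.
Proof. by apply: f2mxP => v; rewrite id_lfunE mulmx1. Qed.

Lemma f2mx_is_linear : linear (@f2mx F V V).
Proof.
move=> a f g; apply: f2mxP => v.
by rewrite add_lfunE scale_lfunE linearP /= !v2r_lfun mulmxDr scalemxAr.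
Qed.
HB.instance Definition _ := GRing.isLinear.Build F 'End(V)
  'M[F]_(dim V, dim V) *:%R (@f2mx F V V) f2mx_is_linear.

Lemma v2r_iter f k v : v2r (iter k f v) = v2r v *m f2mx f ^+ k.
Proof.
elim: k => [|k IH] /=; first by rewrite mulmx1.
by rewrite v2r_lfun IH exprSr [_ * f2mx f]/GRing.mul /= mulmxA.
Qed.

Lemma f2mx_expr0 f k : f2mx f ^+ k = 0 <-> forall v, iter k f v = 0.
Proof.
split=> [fk v|fk]; first by apply: v2r_inj; rewrite v2r_iter fk mulmx0 linear0.
apply/row_matrixP => i; rewrite !rowE -(r2vK (delta_mx 0 i)).
by rewrite -v2r_iter fk linear0 mulmx0.
Qed.

Definition lftrace f := \tr (f2mx f).

Lemma lftrace_is_linear : scalar lftrace.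
Proof. by move=> a f g; rewrite /lftrace linearP mxtraceD mxtraceZ. Qed.
HB.instance Definition _ := GRing.isLinear.Build F 'End(V) F *%R lftrace
  lftrace_is_linear.

Lemma lftraceC f g : lftrace (f \o g)%VF = lftrace (g \o f)%VF.
Proof. by rewrite /lftrace !f2mx_comp mxtrace_mulC. Qed.

(** A subspace of maximal dimension inside P absorbs every further vector of P. *)
Lemma vspace_pred (P : V -> Prop) :
  P 0 -> (forall a u v, P u -> P v -> P (a *: u + v)) ->
  exists U : {vspace V}, forall v, v \in U <-> P v.
Proof.
move=> P0 PP; pose Q k := `[< exists2 U : {vspace V}, \dim U = k & forall v, v \in U -> P v >].
have Q0 : exists k, Q k.
  by exists 0%N; apply/asboolP; exists 0%VS; rewrite ?dimv0 // => v; rewrite memv0 => /eqP->.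
have Qle k : Q k -> (k <= \dim {:V})%N.
  by move=> /asboolP[U <- _]; rewrite dimvS ?subvf.
case: (ex_maxnP Q0 Qle) => k /asboolP[U dU UP] kmax; exists U => v; split; first exact: UP.
move=> Pv; have : Q (\dim (<[v]> + U)%VS).
  apply/asboolP; exists (<[v]> + U)%VS => // _ /memv_addP[_ /vlineP[a ->] [u /UP Pu ->]].
  exact: PP.
move/kmax; rewrite -dU => le; have /eqP -> : U == (<[v]> + U)%VS.
  by rewrite eqEdim addvSr le.
exact: (subvP (addvSl _ _) _ (memv_line v)).
Qed.

End LinearFunctions.

Section LieBracket.
Variables (F : fieldType) (V : vectType F) (br : lie_bracket V).
Implicit Types x y z : V.

Lemma brPl a x y z : br (a *: x + y) z = a *: br x z + br y z.
Proof. exact: (bracket_linearl br z a x y). Qed.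

Lemma brDl x y z : br (x + y) z = br x z + br y z.
Proof. by rewrite -[x]scale1r brPl !scale1r. Qed.

Lemma br0l z : br 0 z = 0.
Proof. by apply: (addrI (br 0 z)); rewrite -brDl !addr0. Qed.

Lemma brZl a x z : br (a *: x) z = a *: br x z.
Proof. by rewrite -[a *: x]addr0 brPl br0l addr0. Qed.

Lemma brNl x z : br (- x) z = - br x z.
Proof. by rewrite -scaleN1r brZl scaleN1r. Qed.

Lemma brBl x y z : br (x - y) z = br x z - br y z.
Proof. by rewrite brDl brNl. Qed.

Lemma brDr x y z : br x (y + z) = br x y + br x z.
Proof. exact: linearD. Qed.

Lemma brZr a x y : br x (a *: y) = a *: br x y.
Proof. exact: linearZ. Qed.

Lemma brNr x y : br x (- y) = - br x y.
Proof. exact: linearN. Qed.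

Lemma brBr x y z : br x (y - z) = br x y - br x z.
Proof. exact: linearB. Qed.

Lemma br0r x : br x 0 = 0.
Proof. exact: linear0. Qed.

Lemma brC x y : br x y = - br y x.
Proof.
apply/eqP; rewrite -addr_eq0; apply/eqP.
by have := bracketxx br (x + y); rewrite brDl !linearD /= !bracketxx add0r addr0.
Qed.

Lemma br_der x y z : br x (br y z) = br (br x y) z + br y (br x z).
Proof.
have := bracket_jacobi br x y z; rewrite (brC z (br x y)) (brC z x) linearN /=.
by move/eqP; rewrite addr_eq0 opprK => /eqP<-; rewrite subrK.
Qed.

Lemma ad_is_linear : linear (ad br).
Proof. by move=> a x y; apply/lfunP => z; rewrite add_lfunE scale_lfunE !adE brPl. Qed.
HB.instance Definition _ := GRing.isLinear.Build F V 'End(V) *:%R (ad br) ad_is_linear.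

Lemma ad_br x y : ad br (br x y) = (ad br x \o ad br y)%VF - (ad br y \o ad br x)%VF.
Proof.
apply/lfunP => z; rewrite add_lfunE opp_lfunE !comp_lfunE !adE br_der.
by rewrite addrK.
Qed.

Lemma iter_ad n x y : iter n (ad br x) y = iter n (br x) y.
Proof. by elim: n => //= n ->; rewrite adE. Qed.

(* The inductive step applies the statement to a maximal proper subalgebra M
   acting on the pair M < L. *)
Lemma engel (L : {vspace V}) :
    (forall x y, x \in L -> y \in L -> br x y \in L) ->
    (forall x, x \in L -> ad_nilpotent br x) ->
  forall U W : {vspace V}, ~~ (W <= U)%VS ->
    (forall x u, x \in L -> u \in U -> br x u \in U) ->
    (forall x w, x \in L -> w \in W -> br x w \in W) ->
  exists2 w, w \in W & w \notin U /\ forall x, x \in L -> br x w \in U.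
Proof.
elim: {L}(\dim L) {-2}L (leqnn (\dim L)) => [|n IH] L dL LL nilL U W nWU LU LW.
  have /subvPn[w Ww Uw] := nWU; exists w => //; split=> // x.
  by move: dL; rewrite leqn0 dimv_eq0 => /eqP->; rewrite memv0 => /eqP->; rewrite br0l mem0v.
have [L0|nL0] := eqVneq L 0%VS.
  have /subvPn[w Ww Uw] := nWU; exists w => //; split=> // x.
  by rewrite L0 memv0 => /eqP->; rewrite br0l mem0v.
pose sub (M : {vspace V}) := forall x y, x \in M -> y \in M -> br x y \in M.
pose Q k := `[< exists M, [/\ sub M, (M <= L)%VS, ~~ (L <= M)%VS & \dim M = k] >].
have Q0 : exists k, Q k.
  exists 0%N; apply/asboolP; exists 0%VS; rewrite sub0v subv0 dimv0 nL0; split=> //.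
  by move=> x y; rewrite !memv0 => /eqP-> _; rewrite br0l.
have Qle k : Q k -> (k <= \dim L)%N by move=> /asboolP[M [_ ML _ <-]]; rewrite dimvS.
case: (ex_maxnP Q0 Qle) => k /asboolP[M [sM ML nLM dM]] kmax.
have {Q0 Qle}ltM : (\dim M <= n)%N.
  rewrite -ltnS (leq_trans _ dL) // ltn_neqAle (dimvS ML) andbT.
  by apply: contra nLM => /eqP dE; have := eqEdim M L; rewrite ML dE leqnn => /eqP->.
have nilM x : x \in M -> ad_nilpotent br x by move/(subvP ML)/nilL.
have [x Lx [nMx Mx]] := IH M ltM sM nilM M L nLM sM
  (fun x y Mx Ly => LL x y (subvP ML x Mx) Ly).
(* As x normalizes M, [<[x]> + M] is a subalgebra, which by maximality of M contains L. *)
have LE : (L <= <[x]> + M)%VS.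
  apply: contraT => nL; have : Q (\dim (<[x]> + M)).
    apply/asboolP; exists (<[x]> + M)%VS; split=> //.
      move=> _ _ /memv_addP[_ /vlineP[a ->] [u Mu ->]] /memv_addP[_ /vlineP[b ->] [v Mv ->]].
      apply: (subvP (addvSr _ _)); rewrite !brDl !linearD /= !brZl !linearZ /=.
      rewrite bracketxx !scaler0 add0r (brC x v).
      by rewrite !(memvD, memvZ, memvN) ?Mx // sM.
    by rewrite subv_add -memvE Lx.
  move/kmax; rewrite -dM; have := dimv_leqif_sup (addvSr <[x]>%VS M).
  case=> le eq le'; have : \dim M == \dim (<[x]> + M) by rewrite eqn_leq le.
  rewrite eq subv_add subvv andbT -memvE.
  by rewrite (negPf nMx).
(* [W'] collects the vectors killed by M modulo U. It is stable under x, since x normalizes M; the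
   last iterate under the nilpotent x that is still outside U is then killed by x as well. *)
have [||W' W'P] := @vspace_pred _ _ (fun w => w \in W /\ forall m, m \in M -> br m w \in U).
- by split=> [|m _]; rewrite ?linear0 mem0v.
- move=> a u v [Wu Mu] [Wv Mv].
  split=> [|m Mm]; first by rewrite memvD ?memvZ.
  by rewrite linearP memvD ?memvZ ?Mu ?Mv.
have [w W'w Uw] : exists2 w, w \in W' & w \notin U.
  have [||w Ww [Uw Mw]] := IH M ltM sM nilM U W nWU.
  - by move=> m u /(subvP ML); apply: LU.
  - by move=> m u /(subvP ML); apply: LW.
  by exists w => //; apply/W'P.
have xW' v : v \in W' -> br x v \in W'.
  move=> /W'P[Wv Mv]; apply/W'P; split; first exact: LW.
  move=> m Mm; rewrite br_der; apply: memvD; first exact/Mv/Mx.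
  exact/LU/Mv.
have [m xm] := nilL x Lx.
have : exists j, iter j (br x) w \in U by exists m; rewrite xm mem0v.
case/ex_minnP => -[|j] jU jmin; first by rewrite jU in Uw.
have jW' : iter j (br x) w \in W' by elim: j {jU jmin} => //= j; apply: xW'.
have jnU : iter j (br x) w \notin U by apply: contraT; rewrite negbK => /jmin; rewrite ltnn.
have /W'P[Wj Mj] := jW'; exists (iter j (br x) w); rewrite ?jnU //; split=> // y /(subvP LE).
case/memv_addP=> _ /vlineP[a ->] [u Mu ->].
by rewrite brDl brZl; apply: memvD; [apply: memvZ | apply: Mj].
Qed.

End LieBracket.

(** * Nondegeneracy of the Killing form *)

Section Killing.
Variables (F : numClosedFieldType) (V : vectType F) (br : lie_bracket V).
Implicit Types x y z : V.

Definition killing x y := lftrace (ad br x \o ad br y)%VF.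

Lemma killing_linearl y : scalar (killing^~ y).
Proof. by move=> a u v; rewrite /killing linearP /= comp_lfunDl -comp_lfunZl linearP. Qed.

Lemma killingC x y : killing x y = killing y x.
Proof. exact: lftraceC. Qed.

Lemma killing_inv x y z : killing (br x y) z = killing x (br y z).
Proof.
rewrite /killing !ad_br comp_lfunDl comp_lfunDr comp_lfunNl comp_lfunNr !linearB /=.
rewrite !comp_lfunA; congr (_ - _).
by rewrite [RHS]lftraceC !comp_lfunA.
Qed.

(** Since (D - a - b)[y, z] = [(D - a) y, z] + [y, (D - b) z], each step lowers one of the two
    exponents. *)
Lemma iter_derivation (D : 'End(V)) (a b : F) j k y z :
    (forall u v, D (br u v) = br (D u) v + br u (D v)) ->
    iter j (D - a *: \1%VF) y = 0 -> iter k (D - b *: \1%VF) z = 0 ->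
  iter (j + k) (D - (a + b) *: \1%VF) (br y z) = 0.
Proof.
move=> derD; have iter0 i (f : 'End(V)) : iter i f 0 = 0.
  by elim: i => //= i ->; rewrite linear0.
have iterD i (f : 'End(V)) u v : iter i f (u + v) = iter i f u + iter i f v.
  by elim: i => //= i ->; rewrite linearD.
move En: (j + k)%N => n; elim: n j k y z En => [|n IH] [|j] [|k] y z //= En.
- by move=> ->; rewrite br0l.
- by move=> -> _; rewrite br0l -iterS iter0.
- by move=> _ ->; rewrite linear0 -iterS iter0.
move=> yj zk; rewrite -iterS iterSr.
have -> : (D - (a + b) *: \1%VF)%R (br y z) =
    br ((D - a *: \1%VF)%R y) z + br y ((D - b *: \1%VF)%R z).
  rewrite !(add_lfunE, opp_lfunE, scale_lfunE, id_lfunE) derD brBl linearB /=.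
  by rewrite [br y (b *: z)]linearZ brZl scalerDl opprD addrACA.
rewrite iterD (IH j k.+1) ?(IH j.+1 k) ?addr0 //.
- by case: En; rewrite addSn addnS.
- by rewrite -iterSr.
- by case: En; rewrite addnS.
by rewrite -iterSr.
Qed.

(* The derivation acts on the generalized eigenspace of x for a as the scalar
   conj a, so its trace against ad x is the sum of the |a|^2. *)
Lemma ad_nilpotent_trace x :
  (forall D : 'End(V), (forall u v, D (br u v) = br (D u) v + br u (D v)) ->
     lftrace (ad br x \o D)%VF = 0) ->
  ad_nilpotent br x.
Proof.
have [S [SP Snil]] := mx_conj_semisimple (f2mx (ad br x)).
pose D : 'End(V) := Hom S.
have genP a y k : iter k (ad br x - a *: \1%VF) y = 0 -> D y = a^* *: y.
  move=> yk; apply: v2r_inj; rewrite v2r_lfun linearZ /=; apply: SP; exists k.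
  have -> : f2mx (ad br x) - a%:M = f2mx (ad br x - a *: \1%VF).
    by rewrite linearB linearZ /= f2mx1 scalemx1.
  by rewrite -v2r_iter yk linear0.
have decP y : exists2 r : seq (F * V), y = \sum_(u <- r) u.2 &
    forall u, u \in r -> exists k, iter k (ad br x - u.1 *: \1%VF) u.2 = 0.
  have : exists2 r : seq (F * 'rV_(dim V)),
      v2r y = \sum_(u <- r) u.2 & forall u, u \in r -> gen_eigenvector (f2mx (ad br x)) u.1 u.2.
    move: (dim V) (v2r y) (f2mx (ad br x)) => [|n] v A.
      by exists [::]; rewrite ?big_nil // [v]thinmx0.
    exact: sum_gen_eigenvectors.
  case=> r rE rP; exists [seq (u.1, r2v u.2) | u <- r].
    by apply: v2r_inj; rewrite big_map linear_sum rE; apply: eq_bigr => u _; rewrite /= r2vK.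
  move=> _ /mapP[u /rP[k uk] ->] /=; exists k; apply: v2r_inj.
  by rewrite v2r_iter linearB linearZ /= f2mx1 scalemx1 r2vK uk linear0.
have derx u v : ad br x (br u v) = br (ad br x u) v + br u (ad br x v).
  by rewrite !adE br_der.
have derD u v : D (br u v) = br (D u) v + br u (D v).
  have [r -> rP] := decP u; have [s -> sP] := decP v.
  rewrite big_seq; elim/big_ind: _ => [|u1 u2 h1 h2|a ar].
  - by rewrite !(br0l, linear0) addr0.
  - by rewrite brDl !linearD /= !brDl h1 h2 addrACA.
  rewrite big_seq; elim/big_ind: _ => [|v1 v2 h1 h2|b bs].
  - by rewrite !linear0 addr0.
  - by rewrite !linearD /= h1 h2 addrACA.
  have [j aj] := rP a ar; have [k bk] := sP b bs.
  rewrite (genP _ _ _ aj) (genP _ _ _ bk) (genP _ _ _ (iter_derivation derx aj bk)).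
  by rewrite brZl linearZ /= rmorphD scalerDl.
move=> /(_ D derD); rewrite lftraceC /lftrace f2mx_comp => /Snil[m /f2mx_expr0 xm].
by exists m => y; rewrite -iter_ad xm.
Qed.

Lemma semisimple_abelian (I : {vspace V}) : semisimple br -> lie_ideal br I ->
  (forall x y, x \in I -> y \in I -> br x y = 0) -> I = 0%VS.
Proof.
move=> ss idI abI; apply: ss => //; exists 1%N => /=.
apply/eqP; rewrite -subv0; apply/lie_prodP => x y Ix Iy.
by rewrite abI ?mem0v.
Qed.

(** Inside the radical R of the form, let I be the part with zero trace against every derivation. It
    contains [R, g], because tr (ad [z, y] D) = - killing z (D y). Its elements are ad-nilpotent, so
    if I were nonzero, Engel's theorem would give it a nonzero center, an abelian ideal of g. Hence
    I = 0, which makes R central, so R = 0. *)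
Lemma killing_nondegenerate x : semisimple br -> (forall y, killing x y = 0) -> x = 0.
Proof.
move=> ss; have [||R RP] := @vspace_pred _ _ (fun x => forall y, killing x y = 0).
- by move=> y; rewrite /killing linear0 comp_lfun0l linear0.
- by move=> a u v Ru Rv y; rewrite killing_linearl Ru Rv mulr0 addr0.
have Rid y z : z \in R -> br y z \in R.
  by move=> /RP Rz; apply/RP => w; rewrite (brC br y) -brNr killing_inv Rz.
pose der (D : 'End(V)) := forall u v, D (br u v) = br (D u) v + br u (D v).
have [||I IP] := @vspace_pred _ _ (fun x => x \in R /\
    forall D, der D -> lftrace (ad br x \o D)%VF = 0).
- by split=> [|D _]; rewrite ?mem0v // linear0 comp_lfun0l linear0.
- move=> a u v [Ru Du] [Rv Dv]; split=> [|D derD]; first by rewrite memvD ?memvZ.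
  by rewrite linearP comp_lfunDl -comp_lfunZl linearP /= Du ?Dv // mulr0 addr0.
have RI y z : z \in R -> br z y \in I.
  move=> Rz; apply/IP; split=> [|D derD]; first by rewrite (brC br) memvN Rid.
  have adD u : ad br (D u) = (D \o ad br u)%VF - (ad br u \o D)%VF.
    apply/lfunP => v; rewrite add_lfunE opp_lfunE !comp_lfunE !adE derD.
    by rewrite addrK.
  apply/eqP; rewrite -oppr_eq0 -[X in _ == X]((RP z).1 Rz (D y)).
  rewrite /killing adD ad_br comp_lfunDl comp_lfunDr comp_lfunNl comp_lfunNr !linearB /=.
  rewrite opprB !comp_lfunA; apply/eqP; congr (_ - _).
  by rewrite [RHS]lftraceC !comp_lfunA.
have idI : lie_ideal br I.
  by move=> y z /IP[Rz _]; rewrite (brC br) memvN RI.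
have I0 : I = 0%VS.
  have [//|nI0] := eqVneq I 0%VS.
  have [|||||w Iw [w0 Iw0]] := @engel _ _ br I _ _ 0%VS I.
  - by move=> y z _; apply: idI.
  - by move=> y /IP[_ trD]; apply: ad_nilpotent_trace => D /trD.
  - by rewrite subv0.
  - by move=> y u _; rewrite !memv0 => /eqP->; rewrite linear0.
  - by move=> y u _; apply: idI.
  have [||Z ZP] := @vspace_pred _ _ (fun w => w \in I /\ forall y, y \in I -> br y w = 0).
  - by split=> [|y _]; rewrite ?mem0v ?linear0.
  - move=> a u v [Iu Zu] [Iv Zv]; split=> [|y Iy]; first by rewrite memvD ?memvZ.
    by rewrite brDr brZr Zu ?Zv // scaler0 addr0.
  have Z0 : Z = 0%VS.
    apply: semisimple_abelian => // [y u /ZP[Iu Zu]|y u /ZP[Iy _] /ZP[_ ->]//].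
    apply/ZP; split=> [|v Iv]; first exact: idI.
    rewrite br_der (Zu _ Iv) linear0 addr0 Zu //.
    by rewrite (brC br) memvN idI.
  have : w \in Z by apply/ZP; split=> // y /Iw0; rewrite memv0 => /eqP.
  by rewrite Z0 (negPf w0).
have R0 : R = 0%VS.
  apply: semisimple_abelian => [//|y z /Rid//|y z /(RI z)]; rewrite I0 memv0.
  by move/eqP.
by move=> /RP; rewrite R0 memv0 => /eqP.
Qed.

End Killing.

Lemma iter_lfun_linear (F : fieldType) (V : vectType F) (f : 'End(V)) k :
  linear (iter k f).
Proof. by move=> a u v; elim: k => //= k ->; rewrite linearP. Qed.
HB.instance Definition _ (F : fieldType) (V : vectType F) (f : 'End(V)) k :=
  GRing.isLinear.Build F V V *:%R (iter k f) (iter_lfun_linear f k).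

Section Coordinates.
Variables (F : fieldType) (V : vectType F).

Definition crd i (v : V) : F := v2r v 0 i.

Lemma crd_inj u v : (forall i, crd i u = crd i v) -> u = v.
Proof. by move=> uv; apply: v2r_inj; apply/rowP => i; apply: uv. Qed.

Lemma crdD i u v : crd i (u + v) = crd i u + crd i v.
Proof. by rewrite /crd linearD mxE. Qed.

Lemma crdN i u : crd i (- u) = - crd i u.
Proof. by rewrite /crd linearN mxE. Qed.

Lemma crdZ i a u : crd i (a *: u) = a * crd i u.
Proof. by rewrite /crd linearZ mxE. Qed.

Lemma crd0 i : crd i 0 = 0.
Proof. by rewrite /crd linear0 mxE. Qed.

Definition crdE := (crdD, crdN, crdZ, crd0).

End Coordinates.

Section LfunLinear.
Variables (F : fieldType) (V : vectType F) (f : 'End(V)).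

Lemma lfD u v : f (u + v) = f u + f v. Proof. exact: linearD. Qed.
Lemma lfN u : f (- u) = - f u. Proof. exact: linearN. Qed.
Lemma lfZ a u : f (a *: u) = a *: f u. Proof. exact: linearZ. Qed.

End LfunLinear.

Ltac lmod_ring := apply: crd_inj => ?; rewrite ?crdE; ring.

(** * Representations of sl_2 *)

Section WeightProduct.
Variables (F : numFieldType) (V : vectType F) (H : 'End(V)).

Fixpoint wprod (s : seq F) (v : V) : V :=
  if s is a :: s' then wprod s' (H v - a *: v) else v.

Lemma wprod_linear s : linear (wprod s).
Proof.
move=> a u v; elim: s u v => //= b s IH u v; rewrite -IH; congr wprod.
by rewrite linearP /= scalerBr scalerDr !scalerA mulrC opprD addrACA.
Qed.
HB.instance Definition _ s := GRing.isLinear.Build F V V *:%R (wprod s) (wprod_linear s).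

Lemma wprod_weight s a v : H v = a *: v -> wprod s v = (\prod_(b <- s) (a - b)) *: v.
Proof.
elim: s v => [|b s IH] v Hv /=; first by rewrite big_nil scale1r.
have E : H v - b *: v = (a - b) *: v by rewrite Hv scalerBl.
by rewrite E linearZ /= IH // big_cons scalerA.
Qed.

Lemma prod_subr_neq0 (s : seq F) a : a \notin s -> \prod_(b <- s) (a - b) != 0.
Proof.
move=> as_; rewrite prodf_seq_neq0; apply/allP => b bs /=.
by rewrite subr_eq0; apply: contraNneq as_ => ->.
Qed.

Lemma wprod_mem s a v : H v = a *: v -> a \in s -> wprod s v = 0.
Proof.
by move=> Hv as_; rewrite (wprod_weight _ Hv) (big_rem a) //= subrr mul0r scale0r.
Qed.

Lemma wprod_eq0 s a v : H v = a *: v -> wprod s v = 0 -> v != 0 -> a \in s.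
Proof.
move=> Hv; rewrite (wprod_weight _ Hv) => /eqP; rewrite scaler_eq0 => /orP[/eqP p0|/eqP-> /eqP//] _.
by apply: contraT => /prod_subr_neq0; rewrite p0 eqxx.
Qed.

(** The vector is killed by (X - a)^2 and by a polynomial with simple roots, whose gcd divides X -
    a. *)
Lemma wprod_jordan s a v : uniq s ->
  H (H v - a *: v) = a *: (H v - a *: v) -> wprod s v = 0 -> H v = a *: v.
Proof.
move=> us Hw; set w := H v - a *: v in Hw.
suff : wprod s v = 0 -> w = 0 by move=> h /h /eqP; rewrite subr_eq0 => /eqP.
elim: s v @w us Hw => [|b s IH] v w /=; first by rewrite /w => _ _ ->; rewrite linear0 scaler0 subr0.
case/andP=> bs us Hw; have [ba|nba] := eqVneq b a.
  rewrite ba -/w (wprod_weight _ Hw) => /eqP; rewrite scaler_eq0 => /orP[/eqP p0|/eqP//].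
  by have := @prod_subr_neq0 s b bs; rewrite ba p0 eqxx.
have wE : H (H v - b *: v) - a *: (H v - b *: v) = (a - b) *: w.
  have Hv : H v = w + a *: v by rewrite /w subrK.
  have -> : H v - b *: v = w + (a - b) *: v by rewrite Hv scalerBl addrA.
  rewrite linearD linearZ /= scalerDr opprD addrACA Hw subrr add0r.
  by rewrite scalerA mulrC -scalerA -scalerBr.
move=> v0; have := IH _ us _ v0; rewrite wE.
rewrite linearZ /= Hw !scalerA mulrC => /(_ erefl)/eqP.
by rewrite scaler_eq0 subr_eq0 eq_sym (negPf nba) => /eqP.
Qed.

End WeightProduct.

Section Sl2Representation.
Variables (F : numClosedFieldType) (V : vectType F).
Implicit Types (E H G : 'End(V)) (u v w : V).

Definition sl2_rep E H G :=
  [/\ forall v, H (E v) = E (H v) + 2 *: E v,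
      forall v, H (G v) = G (H v) - 2 *: G v &
      forall v, E (G v) = G (E v) + H v].

Lemma sl2_rep_sym E H G : sl2_rep E H G -> sl2_rep G (- H) E.
Proof.
case=> HE HG EG; split=> v; rewrite !opp_lfunE.
- by rewrite HG linearN /= opprB addrC.
- by rewrite HE linearN /= opprD.
- by rewrite EG addrK.
Qed.

(** Up to the nonzero factor 2 k, the power E^k is a commutator with H, hence has trace 0 for every
    k > 0. *)
Lemma sl2_nilpotent E H G : sl2_rep E H G -> exists m, forall v, iter m E v = 0.
Proof.
case=> HE _ _; set e := f2mx E; set h := f2mx H.
have eh : e *m h = h *m e + 2 *: e.
  rewrite /e /h -!f2mx_comp -linearZ -linearD; congr f2mx; apply/lfunP => v.
  by rewrite add_lfunE scale_lfunE !comp_lfunE HE.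
have ekh k : e ^+ k *m h = h *m e ^+ k + (2 * k)%:R *: e ^+ k.
  elim: k => [|k IH]; first by rewrite muln0 scale0r addr0 mulmx1 mul1mx.
  rewrite !exprS [_ * _]/GRing.mul /= -mulmxA IH mulmxDr !mulmxA eh mulmxDl.
  rewrite -scalemxAr -scalemxAl -addrA -scalerDl mulnS natrD.
  by rewrite -!mulmxA.
have [k _|m em] := @mx_nilpotent_trace _ _ e; last by exists m; apply/f2mx_expr0.
have /(congr1 mxtrace)/eqP := ekh k.+1.
rewrite mxtraceD mxtrace_mulC -subr_eq0 opprD addrA subrr add0r mxtraceZ oppr_eq0.
by rewrite mulf_eq0 pnatr_eq0 => /eqP.
Qed.

Lemma sl2_power E H G k v : sl2_rep E H G ->
  E (iter k.+1 G v) = iter k.+1 G (E v) + k.+1%:R *: iter k G (H v - k%:R *: v).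
Proof.
case=> HE HG EG; have HGk j w : H (iter j G w) = iter j G (H w - (2 * j)%:R *: w).
  elim: j => [|j IH] /=; first by rewrite muln0 scale0r subr0.
  rewrite HG IH mulnS natrD (scalerDl w 2) opprD [- _ - _]addrC addrA.
  by rewrite [iter j G (_ - 2 *: w)]linearB [G (_ - _)]linearB /= !linearZ.
elim: k => [|k IH]; first by rewrite /= EG scale0r subr0 scale1r.
set z := H v - k%:R *: v in IH.
rewrite -[iter k.+2 G v]/(G (iter k.+1 G v)) EG IH HGk linearD linearZ -addrA; congr (_ + _).
transitivity (k.+1%:R *: iter k.+1 G z + iter k.+1 G (H v - (2 * k.+1)%:R *: v)).
  by [].
rewrite -[LHS]linearP -[RHS]linearZ.
congr (iter k.+1 G _); rewrite /z -[X in _ + (X - _)]scale1r !scalerBr !scalerA.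
rewrite addrACA -opprD -!scalerDl -natrM -natrD -[1]/(1%:R) -natrD -natrM.
by congr (_%:R *: _ - _%:R *: _); lia.
Qed.

(** Decreasing order puts first the factor H - k that [sl2_power] splits off. *)
Definition nat_weights m : seq F := [seq j%:R | j <- rev (iota 0 m)].

Lemma nat_weightsS m : nat_weights m.+1 = m%:R :: nat_weights m.
Proof. by rewrite /nat_weights -addn1 iotaD rev_cat. Qed.

Lemma uniq_nat_weights m : uniq (nat_weights m).
Proof.
rewrite map_inj_uniq ?rev_uniq ?iota_uniq // => i j /eqP.
by rewrite eqr_nat => /eqP.
Qed.

Lemma nat_weightsP m a : a \in nat_weights m -> exists i : nat, a = i%:R.
Proof. by case/mapP=> i _ ->; exists i. Qed.

(* Modulo U, the vector v is killed by E, and then E^m G^m acts on it as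
   m! H (H - 1) ... (H - m + 1). *)
Lemma sl2_highest E H G (U : {vspace V}) m v : sl2_rep E H G ->
    (forall u, u \in U -> [/\ E u \in U, H u \in U & G u \in U]) ->
  E v \in U -> (forall w, iter m G w = 0) -> wprod H (nat_weights m) v \in U.
Proof.
move=> EHG stU Ev Gm; have [HE HG EG] := EHG.
suff H0 k w : E w \in U ->
    iter k E (iter k G w) - k`!%:R *: wprod H (nat_weights k) w \in U.
  have := H0 m v Ev; rewrite Gm linear0 sub0r memvN => mU.
  rewrite -[wprod _ _ _]scale1r -(@mulVf _ m`!%:R) ?pnatr_eq0 -?lt0n ?fact_gt0 //.
  by rewrite -scalerA memvZ.
have stE j u : u \in U -> iter j E u \in U.
  by move=> uU; elim: j => //= j /stU[].
have stG j u : u \in U -> iter j G u \in U.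
  by move=> uU; elim: j => //= j /stU[].
elim: k w => [|k IH] w Ew; first by rewrite /= scale1r subrr mem0v.
rewrite iterSr (sl2_power k w EHG) linearD -addrA memvD ?stE ?stG //.
rewrite nat_weightsS /= linearZ /= factS natrM -scalerA -scalerBr memvZ // IH //.
rewrite linearB linearZ /= memvB ?memvZ //.
have -> : E (H w) = H (E w) - 2 *: E w by rewrite HE addrK.
by rewrite memvB ?memvZ //; case: (stU _ Ew).
Qed.

Lemma highest_weight E H G : sl2_rep E H G ->
  exists m, forall v, E v = 0 -> wprod H (nat_weights m) v = 0.
Proof.
move=> EHG; have [m Gm] := sl2_nilpotent (sl2_rep_sym EHG).
exists m => v Ev; apply/eqP; rewrite -memv0.
apply: (sl2_highest EHG) => //; last by rewrite Ev mem0v.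
by move=> u; rewrite memv0 => /eqP->; rewrite !linear0 mem0v.
Qed.

Lemma highest_weight_nat E H G a v : sl2_rep E H G ->
  E v = 0 -> H v = a *: v -> v != 0 -> exists i : nat, a = i%:R.
Proof.
move=> EHG Ev Hv v0; have [m mP] := highest_weight EHG.
exact: nat_weightsP (wprod_eq0 Hv (mP v Ev) v0).
Qed.

(** Twice the usual E G + G E + H^2 / 2, with E moved to the right so that it acts on a highest
    weight vector of weight a by the scalar [cas a]. *)
Definition casimir E H G : 'End(V) :=
  4 *: (G \o E)%VF + (H \o H)%VF + 2 *: H.

Definition cas (a : F) := a ^+ 2 + 2 * a.

Lemma casimirE E H G v : casimir E H G v = 4 *: G (E v) + H (H v) + 2 *: H v.
Proof. by rewrite !add_lfunE !scale_lfunE !comp_lfunE. Qed.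

Lemma casimir_highest E H G a v :
  E v = 0 -> H v = a *: v -> casimir E H G v = cas a *: v.
Proof.
move=> Ev Hv; rewrite casimirE Ev linear0 scaler0 add0r Hv linearZ /= Hv !scalerA.
by rewrite -scalerDl.
Qed.

Lemma casimir_comm E H G : sl2_rep E H G ->
  [/\ forall v, casimir E H G (E v) = E (casimir E H G v),
      forall v, casimir E H G (H v) = H (casimir E H G v) &
      forall v, casimir E H G (G v) = G (casimir E H G v)].
Proof.
case=> HE HG EG; split=> v; rewrite !casimirE !(lfD, lfN, lfZ).
- by rewrite EG !HE !(lfD, lfN, lfZ) !HE; lmod_ring.
- by rewrite HG HE !(lfD, lfN, lfZ); lmod_ring.
- by rewrite EG !HG !(lfD, lfN, lfZ) !HG; lmod_ring.
Qed.

Lemma cas_eq (a b : F) : cas a = cas b -> a = b \/ a + b = - 2.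
Proof.
move=> /eqP; rewrite -subr_eq0 (_ : _ - _ = (a - b) * (a + b + 2)); last by rewrite /cas; ring.
by rewrite mulf_eq0 subr_eq0 addr_eq0 => /orP[/eqP|/eqP]; [left|right].
Qed.

End Sl2Representation.

(** * Diagonalizability of H, with integral weights *)

Section Sl2Weights.
Variables (F : numClosedFieldType) (V : vectType F) (E H G : 'End(V)).
Hypothesis EHG : sl2_rep E H G.
Implicit Types (u v w : V) (a b : F) (d : int).

Let Om := casimir E H G.

(** The factors run over the Casimir eigenvalues of the highest weights a, a + 2, ..., a + 2 (K -
    1), those above which a vector of weight a killed by E^K cannot reach. *)
Fixpoint cprod K a v : V :=
  if K is K'.+1 then cprod K' a (Om v - cas (a + (2 * K')%:R) *: v) else v.

Lemma cprod_linear K a : linear (cprod K a).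
Proof.
move=> b u v; elim: K u v => //= K IH u v; rewrite -IH; congr cprod.
by rewrite lfD lfZ; lmod_ring.
Qed.
HB.instance Definition _ K a :=
  GRing.isLinear.Build F V V *:%R (cprod K a) (cprod_linear K a).

Lemma cprod_comm K a (T : 'End(V)) v :
  (forall w, Om (T w) = T (Om w)) -> cprod K a (T v) = T (cprod K a v).
Proof.
move=> OT; elim: K v => //= K IH v; rewrite -IH OT; congr cprod.
by rewrite lfD lfN lfZ.
Qed.

Lemma cprod_eigen K a c v : Om v = c *: v ->
  cprod K a v = (\prod_(k < K) (c - cas (a + (2 * k)%:R))) *: v.
Proof.
elim: K v => [|K IH] v Ov /=; first by rewrite big_ord0 scale1r.
by rewrite Ov -scalerBl linearZ /= IH // scalerA big_ord_recr mulrC.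
Qed.

Lemma weight_E a v : H v = a *: v -> H (E v) = (a + 2) *: E v.
Proof. by case: EHG => HE _ _ Hv; rewrite HE Hv lfZ -scalerDl. Qed.

Lemma weight_G a v : H v = a *: v -> H (G v) = (a - 2) *: G v.
Proof. by case: EHG => _ HG _ Hv; rewrite HG Hv lfZ -scalerBl. Qed.

Lemma weight_iterE a v k : H v = a *: v ->
  H (iter k E v) = (a + (2 * k)%:R) *: iter k E v.
Proof.
move=> Hv; elim: k => [|k IH] /=; first by rewrite muln0 addr0.
by rewrite (weight_E IH) -addrA -natrD mulnSr.
Qed.

(** If E^(K + 1) v = 0, then E^K v is a highest weight vector of weight a + 2 K; as the Casimir
    operator commutes with E, its factor for this weight sends v to a vector killed by E^K. *)
Lemma cprod_weight K a v : H v = a *: v -> iter K E v = 0 -> cprod K a v = 0.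
Proof.
have [OE OH _] := casimir_comm EHG.
elim: K v => [|K IH] v //= Hv EK; apply: IH.
  by rewrite lfD lfN lfZ -OH Hv !lfZ; lmod_ring.
have OK : iter K E (Om v) = Om (iter K E v).
  by elim: (K) => //= k ->; rewrite OE.
rewrite linearB linearZ /= OK (casimir_highest G EK (weight_iterE K Hv)).
by rewrite subrr.
Qed.

(* c_j - c_(j + 2 + 2 k) = - (2 + 2 k) (2 j + 4 + 2 k) *)
Lemma cas_prod_neq0 (j : nat) K :
  \prod_(k < K) (cas j%:R - cas (j%:R + 2 + (2 * k)%:R)) != 0 :> F.
Proof.
apply/prodf_neq0 => k _.
have -> : cas j%:R - cas (j%:R + 2 + (2 * k)%:R) =
  - ((2 + 2 * k) * (2 * j + 4 + 2 * k))%:R :> F.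
  by rewrite /cas !(natrM, natrD); ring.
by rewrite oppr_eq0 pnatr_eq0; lia.
Qed.

Definition weight_sum (P : int -> Prop) v := exists2 r : seq (int * V),
  v = \sum_(x <- r) x.2 &
  forall x, x \in r -> P x.1 /\ H x.2 = x.1%:~R *: x.2.

Lemma weight_sum_vspace P :
  exists U : {vspace V}, forall v, v \in U <-> weight_sum P v.
Proof.
apply: vspace_pred => [|a _ _ [r -> rP] [s -> sP]].
  by exists [::]; rewrite ?big_nil.
exists ([seq (x.1, a *: x.2) | x <- r] ++ s).
  by rewrite big_cat big_map scaler_sumr.
move=> x; rewrite mem_cat => /orP[/mapP[y /rP[Py yE] ->]|/sP//] /=; split=> //.
by rewrite lfZ yE !scalerA mulrC.
Qed.

Lemma weight_sum1 (P : int -> Prop) d v : P d -> H v = d%:~R *: v -> weight_sum P v.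
Proof.
by move=> Pd Hv; exists [:: (d, v)]; rewrite ?big_seq1 // => x; rewrite inE => /eqP->.
Qed.

Lemma weight_sum_wprod P v : weight_sum P v ->
  exists2 s : seq F, uniq s & wprod H s v = 0.
Proof.
case=> r -> rP; exists (undup [seq x.1%:~R | x <- r]); first exact: undup_uniq.
rewrite linear_sum big_seq big1 // => x xr; have [_ Hx] := rP x xr.
by apply: (wprod_mem Hx); rewrite mem_undup; apply: map_f.
Qed.

Lemma weight_sum_ind (P : int -> Prop) (Q : V -> Prop) : Q 0 ->
  (forall u v, Q u -> Q v -> Q (u + v)) ->
  (forall d v, P d -> H v = d%:~R *: v -> Q v) ->
  forall v, weight_sum P v -> Q v.
Proof.
move=> Q0 QD Qw v [r -> rP]; rewrite big_seq; elim/big_ind: _ => // x /rP[Px Hx].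
exact: Qw Px Hx.
Qed.

Let anyw d := True.

(** If the span W of the integral weight vectors were proper, [sl2_highest] modulo W would give v
    outside W with E v and (H - i) v in W for some natural i. Once v is corrected by an element of
    W, w = (H - i) v is a highest weight vector of weight i and E v has weight i + 2. The Casimir
    product from i + 2 on kills E v, so it sends v into the kernel of E, where H is diagonalizable;
    this kills the image of w. But the product is a nonzero scalar on w, so w = 0 and v is in W. *)
Lemma weight_sum_all v : weight_sum anyw v.
Proof.
have [W WP] := weight_sum_vspace anyw; apply/WP.
have stW u : u \in W -> [/\ E u \in W, H u \in W & G u \in W].
  move=> /WP[r -> rP]; rewrite !linear_sum !big_seq.
  split; apply: memv_suml => x /rP[_ Hx]; apply/WP.
  - by apply: (@weight_sum1 _ (x.1 + 2)) => //; rewrite (weight_E Hx) intrD.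
  - by apply: (@weight_sum1 _ x.1) => //=; rewrite !(Hx, lfZ).
  - by apply: (@weight_sum1 _ (x.1 - 2)) => //; rewrite (weight_G Hx) intrD.
have [m Em] := sl2_nilpotent EHG; have [n Gn] := sl2_nilpotent (sl2_rep_sym EHG).
apply: contraT => nv.
have {v nv} [v nv Ev] : exists2 v, v \notin W & E v \in W.
  have : exists j, iter j E v \in W by exists m; rewrite Em mem0v.
  case/ex_minnP => -[|j] jW jmin; first by rewrite (negPf nv) in jW.
  by exists (iter j E v) => //; apply/negP => /jmin; rewrite ltnn.
have {v nv Ev} [i [v [nv Ev Hv]]] : exists i : nat, exists v,
    [/\ v \notin W, E v \in W & H v - i%:R *: v \in W].
  have := sl2_highest EHG stW Ev Gn.
  have := @nat_weightsP F n; elim: (nat_weights F n) v nv Ev => [|a s IH] v nv Ev sP /=.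
    by rewrite (negPf nv).
  have [i ai] := sP a (mem_head _ _).
  have [vW|nvW] := boolP (H v - a *: v \in W); first by exists i, v; rewrite -ai.
  apply: IH => // [|b bs]; last by apply: sP; rewrite inE bs orbT.
  have [HE _ _] := EHG; have -> : E (H v - a *: v) = H (E v) - (2 + a) *: E v.
    by rewrite HE lfD lfN lfZ; lmod_ring.
  by rewrite memvB ?memvZ //; case: (stW _ Ev).
(* H - i is invertible on the weights other than i, so those components of (H - i) v are removed by
   subtracting a vector [u] of W. *)
have {v nv Ev Hv} [v [nv Ev Hw]] : exists v, [/\ v \notin W, E v \in W &
    H (H v - i%:R *: v) = i%:R *: (H v - i%:R *: v)].
  have /WP[r rE rP] := Hv.
  pose u := \sum_(x <- r | x.1 != i) (x.1%:~R - i%:R)^-1 *: x.2.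
  have uW : u \in W.
    rewrite /u big_seq_cond; apply: memv_suml => x /andP[/rP[_ Hx] _].
    by rewrite memvZ //; apply/WP; apply: weight_sum1 Hx.
  have Hu : H u - i%:R *: u = \sum_(x <- r | x.1 != i) x.2.
    rewrite /u linear_sum scaler_sumr -sumrB big_seq_cond [RHS]big_seq_cond.
    apply: eq_bigr => x /andP[/rP[_ Hx] xi]; rewrite /= lfZ Hx.
    rewrite !scalerA -scalerBl mulrC -mulrBl divff ?scale1r //.
    by rewrite -[i%:R]/(i%:~R) -intrB intr_eq0 subr_eq0.
  exists (v - u); split; first by apply: contra nv => vu; rewrite -(subrK u v) memvD.
    by rewrite lfD lfN memvB //; case: (stW _ uW).
  have -> : H (v - u) - i%:R *: (v - u) = \sum_(x <- r | x.1 == i) x.2.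
    have -> : H (v - u) - i%:R *: (v - u) = (H v - i%:R *: v) - (H u - i%:R *: u).
      by rewrite lfD lfN; lmod_ring.
    by rewrite rE Hu (bigID (fun x : int * V => x.1 == i)) /= addrK.
  rewrite linear_sum scaler_sumr big_seq_cond [RHS]big_seq_cond.
  by apply: eq_bigr => x /andP[/rP[_ Hx] /eqP xi] /=; rewrite Hx xi.
set w := H v - i%:R *: v in Hw.
have [OE OH _] := casimir_comm EHG.
have HEv : H (E v) - (i%:R + 2) *: E v = E w.
  by have [HE _ _] := EHG; rewrite HE /w lfD lfN lfZ; lmod_ring.
have wtE : H (E v) = (i%:R + 2) *: E v.
  have /WP/weight_sum_wprod[s us sv] := Ev.
  by apply: wprod_jordan us _ sv; rewrite HEv (weight_E Hw).
have Ew : E w = 0 by rewrite -HEv wtE subrr.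
pose z := cprod m (i%:R + 2) v.
have Ez : E z = 0 by rewrite -cprod_comm // (cprod_weight wtE (Em _)).
have Hz : H z - i%:R *: z = cprod m (i%:R + 2) w by rewrite -cprod_comm // -linearZ -linearB.
rewrite (cprod_eigen _ _ (casimir_highest G Ew Hw)) in Hz.
have [k kP] := highest_weight EHG.
have Hz0 : H z = i%:R *: z.
  apply: wprod_jordan (uniq_nat_weights F k) _ (kP z Ez).
  by rewrite Hz lfZ Hw !scalerA mulrC.
move: Hz; rewrite Hz0 subrr => /esym/eqP; rewrite scaler_eq0 (negPf (cas_prod_neq0 _ _)) /=.
rewrite subr_eq0 => /eqP Hv.
suff vW : v \in W by rewrite vW in nv.
by apply/WP; apply: (@weight_sum1 _ i).
Qed.

End Sl2Weights.

Section Sl2Decomposition.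
Variables (F : numClosedFieldType) (V : vectType F).
Implicit Types (E H G : 'End(V)) (u v w : V) (d : int).

Definition weight_projections H (S : seq int) (pi : int -> 'End(V)) :=
  [/\ forall v, v = \sum_(d <- S) pi d v,
      forall d v, H (pi d v) = d%:~R *: pi d v,
      forall d v, H v = d%:~R *: v -> pi d v = v &
      forall d b v, b != d -> H v = b%:~R *: v -> pi d v = 0].

Lemma weight_projections_exist E H G : sl2_rep E H G ->
  exists S, exists pi, weight_projections H S pi.
Proof.
move=> EHG.
have [S SP] : exists S : seq int, forall v, weight_sum H (fun d => d \in S) v.
  have [S SX] : exists S : seq int, forall v, v \in (vbasis {:V} : seq V) ->
      weight_sum H (fun d => d \in S) v.
    elim: (vbasis {:V} : seq V) => [|x X [S SP]]; first by exists [::] => v; rewrite in_nil.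
    have [r xE rP] := weight_sum_all EHG x; exists ([seq y.1 | y <- r] ++ S) => v.
    rewrite inE => /predU1P[->|/SP[t tE tP]].
      by exists r => // y yr; case: (rP y yr) => _ ->; split=> //; rewrite mem_cat map_f.
    by exists t => // y /tP[yS ->]; rewrite mem_cat yS orbT; split.
  exists S => v; have [U UP] := weight_sum_vspace H (fun d => d \in S).
  apply/UP; move: v (memvf v); apply/subvP; rewrite -(span_basis (vbasisP {:V})).
  by apply/span_subvP => v /SX /UP.
(* [pi d] is a Lagrange interpolation polynomial in H; for d outside [S'] the product runs over all
   the weights and [pi d] is 0. *)
pose S' := undup S; pose T d := [seq b%:~R : F | b <- S' & b != d].
pose c d := \prod_(b <- T d) (d%:~R - b).
pose pi d : 'End(V) := linfun ((c d)^-1 \*: wprod H (T d)).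
have inj : injective (fun b : int => b%:~R : F) := intr_inj.
have c0 d : c d != 0.
  apply: prod_subr_neq0; rewrite mem_map //.
  by rewrite mem_filter eqxx.
have mS d v : H v = d%:~R *: v -> v != 0 -> d \in S'.
  move=> Hv; have [r vE rP] := SP v.
  have : wprod H [seq b%:~R | b <- S'] v = 0.
    rewrite vE linear_sum big_seq big1 // => x /rP[xS Hx].
    by apply: (wprod_mem Hx); rewrite mem_map // mem_undup.
  by move/(wprod_eq0 Hv) => h /h; rewrite mem_map.
have pi1 d v : H v = d%:~R *: v -> pi d v = v.
  by move=> Hv; rewrite lfunE /= (wprod_weight _ Hv) scalerA mulVf ?scale1r.
have pi0 d b v : b != d -> H v = b%:~R *: v -> pi d v = 0.
  move=> bd Hv; have [->|v0] := eqVneq v 0; first by rewrite linear0.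
  rewrite lfunE /= (wprod_mem Hv) ?scaler0 // mem_map //.
  by rewrite mem_filter bd (mS _ _ Hv).
exists S', pi; split=> // [v|d v].
  have [r -> rP] := SP v.
  under [RHS]eq_bigr do rewrite linear_sum /=.
  rewrite [RHS]exchange_big /= big_seq [RHS]big_seq; apply: eq_bigr => x /rP[xS Hx].
  rewrite (big_rem x.1) /=; last by rewrite mem_undup.
  rewrite pi1 // big_seq big1 ?addr0 // => d.
  by rewrite mem_rem_uniq ?undup_uniq // inE eq_sym => /andP[dx _]; apply: pi0 dx Hx.
have [r -> rP] := SP v; rewrite !linear_sum /= big_seq [RHS]big_seq.
apply: eq_bigr => x /rP[_ Hx] /=.
have [xd|xd] := eqVneq x.1 d; first by rewrite pi1 ?Hx ?xd.
by rewrite (pi0 _ _ _ xd Hx) linear0 scaler0.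
Qed.

Lemma projection_shift H S pi (T : 'End(V)) (t : int) v :
    weight_projections H S pi ->
    (forall (b : int) w, H w = b%:~R *: w -> H (T w) = (b + t)%:~R *: T w) ->
  forall d, pi (d + t) (T v) = T (pi d v).
Proof.
case=> sumS piH pi1 pi0 HT d; rewrite {1}[v]sumS !linear_sum /=.
rewrite {2}[v]sumS !linear_sum /=; apply: eq_bigr => b _.
have Hb := HT b _ (piH b v); have [bd|bd] := eqVneq b d.
  by rewrite -bd (pi1 _ _ Hb) (pi1 _ _ (piH b v)).
rewrite (pi0 d b _ bd (piH b v)) linear0 (pi0 _ (b + t) _ _ Hb) //.
by rewrite (inj_eq (addIr t)).
Qed.

Lemma weight_Ez E H G : sl2_rep E H G ->
  forall d w, H w = d%:~R *: w -> H (E w) = (d + 2)%:~R *: E w.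
Proof. by move=> EHG d w Hw; rewrite (weight_E EHG Hw) intrD. Qed.

Lemma weight_Gz E H G : sl2_rep E H G ->
  forall d w, H w = d%:~R *: w -> H (G w) = (d - 2)%:~R *: G w.
Proof. by move=> EHG d w Hw; rewrite (weight_G EHG Hw) intrD. Qed.

(** By projection, let u = G w in ker E have weight i and w weight i + 2. The Casimir product from i
    + 2 on kills w, hence u; but it acts on the highest weight vector u by a nonzero scalar. *)
Lemma lker_limg_trivial E H G : sl2_rep E H G -> (limg G :&: lker E = 0)%VS.
Proof.
move=> EHG; have [S [pi piP]] := weight_projections_exist EHG.
have [sumS piH _ _] := piP; have [_ _ OG] := casimir_comm EHG.
have [K EK] := sl2_nilpotent EHG.
apply/eqP; rewrite -subv0; apply/subvP => _ /memv_capP[/memv_imgP[w _ ->]].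
rewrite memv_ker memv0 => /eqP EGw; rewrite [G w]sumS big1_seq // => d _.
have piG : pi d (G w) = G (pi (d + 2) w).
  by rewrite -(projection_shift w piP (weight_Gz EHG)) addrK.
have EG0 : E (G (pi (d + 2) w)) = 0.
  by rewrite -piG -(projection_shift _ piP (weight_Ez EHG)) EGw linear0.
rewrite piG.
apply/eqP; apply: contraT => u0.
have Hw := piH (d + 2) w; have Hu := weight_Gz EHG Hw; rewrite addrK in Hu.
have [i di] := highest_weight_nat EHG EG0 Hu u0.
have : cprod E H G K (i%:R + 2) (G (pi (d + 2) w)) = 0.
  rewrite cprod_comm // (cprod_weight EHG) ?linear0 //.
  by rewrite Hw intrD di.
rewrite di in Hu; rewrite (cprod_eigen _ _ (casimir_highest G EG0 Hu)) => /eqP.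
by rewrite scaler_eq0 (negPf u0) (negPf (cas_prod_neq0 _ _ _)).
Qed.

(** The sums im E + ker G and im G + ker E are both direct, and their dimensions add up to twice
    that of V, so both are full. *)
Lemma limg_lker_direct E H G : sl2_rep E H G ->
  (limg E :&: lker G = 0)%VS /\ (limg E + lker G = fullv)%VS.
Proof.
move=> EHG; have c1 := lker_limg_trivial EHG.
have c2 := lker_limg_trivial (sl2_rep_sym EHG); split=> //.
apply/eqP; rewrite eqEdim subvf /=.
have dE := limg_ker_dim E fullv; have dG := limg_ker_dim G fullv.
rewrite !capfv in dE dG.
have := dimv_sum_cap (limg G) (lker E); have := dimv_sum_cap (limg E) (lker G).
rewrite c1 c2 dimv0 !addn0 => -> d1.
have := dimvS (subvf (limg G + lker E)); lia.
Qed.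

(** In the decomposition im E + ker G, the second summand has only weights at most 0. *)
Lemma sl2_surj E H G d v : sl2_rep E H G -> 0 < d -> H v = d%:~R *: v ->
  exists2 w, H w = (d - 2)%:~R *: w & v = E w.
Proof.
move=> EHG d0 Hv; have [S [pi piP]] := weight_projections_exist EHG.
have [_ piH pi1 _] := piP.
have /memv_addP[_ /memv_imgP[x _ ->] [y Gy vE]] : v \in (limg E + lker G)%VS.
  by rewrite (limg_lker_direct EHG).2 memvf.
exists (pi (d - 2) x); first exact: piH.
have shE := projection_shift x piP (weight_Ez EHG) (d - 2).
have shG := projection_shift y piP (weight_Gz EHG) d.
rewrite memv_ker in Gy; rewrite (eqP Gy) linear0 in shG.
rewrite subrK in shE; rewrite -(pi1 _ _ Hv) {1}vE linearD /= shE.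
suff -> : pi d y = 0 by rewrite addr0.
apply/eqP; apply: contraT => y0.
have Hy : (- H)%R (pi d y) = (- d)%:~R *: pi d y.
  by rewrite opp_lfunE piH intrN scaleNr.
have [i di] := highest_weight_nat (sl2_rep_sym EHG) (esym shG) Hy y0.
by move: di => /(@intr_inj F (- d) i); lia.
Qed.

(** This triple has E + G in the place of H and, by [casimir_half], the same Casimir operator. *)
Lemma sl2_rep_half E H G : sl2_rep E H G ->
  sl2_rep (2^-1 *: (H - (E - G))) (E + G) (2^-1 *: (H + (E - G))).
Proof.
case=> HE HG EG; have n2 : 2 != 0 :> F by rewrite pnatr_eq0.
have sc v (x : V) : v = x <-> 2 *: v = 2 *: x.
  by split=> [->//|/(scalerI n2)].
split=> v; rewrite !(add_lfunE, opp_lfunE, scale_lfunE)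
  !(lfD, lfN, lfZ, add_lfunE, opp_lfunE, scale_lfunE) !(HE, HG, EG) ?(lfD, lfN, lfZ).
- by apply: crd_inj => i; rewrite !crdE; field.
- by apply: crd_inj => i; rewrite !crdE; field.
- by apply: crd_inj => i; rewrite !crdE; field.
Qed.

Lemma casimir_half E H G : sl2_rep E H G ->
  casimir (2^-1 *: (H - (E - G))) (E + G) (2^-1 *: (H + (E - G))) = casimir E H G.
Proof.
case=> HE HG EG; apply/lfunP => v; rewrite !casimirE.
rewrite !(lfD, lfN, lfZ, add_lfunE, opp_lfunE, scale_lfunE) !(HE, HG, EG) ?(lfD, lfN, lfZ).
by apply: crd_inj => i; rewrite !crdE; field.
Qed.

Definition odd_weight d := odd `|d|%N.

(** A vector killed by E + G has weight 0 for the triple of [sl2_rep_half], so it is killed by a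
    product of factors Om - cas (2 k), where Om is the Casimir operator. On odd weights these
    factors are injective. *)
Lemma sl2_odd_injective E H G v : sl2_rep E H G ->
  weight_sum H odd_weight v -> E v + G v = 0 -> v = 0.
Proof.
move=> EHG vodd EGv; have [S [pi piP]] := weight_projections_exist EHG.
have [sumS piH pi1 pi0] := piP.
have [K EK] := sl2_nilpotent (sl2_rep_half EHG); have [L EL] := sl2_nilpotent EHG.
have [OE OH OG] := casimir_comm EHG.
have cv : cprod E H G K 0 v = 0.
  have <- : cprod (2^-1 *: (H - (E - G))) (E + G) (2^-1 *: (H + (E - G))) K 0 v =
      cprod E H G K 0 v.
    by elim: (K) {EK} v {vodd EGv} => //= k IH v; rewrite casimir_half // IH.
  apply: (cprod_weight (sl2_rep_half EHG)) => //.
  by rewrite scale0r add_lfunE.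
have inj k d w : odd_weight d -> H w = d%:~R *: w -> cprod E H G k 0 w = 0 -> w = 0.
  move=> od; elim: k w => [//|k IH] w Hw /= /IH.
  have -> : H (casimir E H G w - cas (0 + (2 * k)%:R) *: w) =
      d%:~R *: (casimir E H G w - cas (0 + (2 * k)%:R) *: w).
    by rewrite lfD lfN lfZ -OH Hw !lfZ; lmod_ring.
  move=> /(_ erefl)/eqP; rewrite subr_eq0 => /eqP Ow.
  apply/eqP; apply: contraT => w0.
  (* The Casimir eigenvalue of w is then also [cas (d + 2 j)] for some j; by [cas_eq], equality with
     [cas (2 k)] contradicts the parity of d. *)
  have := cprod_weight EHG Hw (EL w).
  rewrite (cprod_eigen _ _ Ow) => /eqP; rewrite scaler_eq0 (negPf w0) orbF.
  case/prodf_eq0 => j _; rewrite subr_eq0 => /eqP/cas_eq.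
  have -> : 0 + (2 * k)%:R = ((2 * k)%N : int)%:~R :> F by rewrite add0r.
  have -> : d%:~R + (2 * j)%:R = (d + (2 * j)%N)%:~R :> F by rewrite intrD.
  rewrite -intrD -[- 2]/((- 2)%:~R : F).
  by move: od; rewrite /odd_weight => od [/intr_inj|/intr_inj]; lia.
rewrite [v]sumS big1_seq // => d _.
have [od|ev] := boolP (odd_weight d).
  apply: (inj K d) => //; rewrite cprod_comm ?cv ?linear0 // => w.
  have := @projection_shift H S pi (casimir E H G) 0 w piP; rewrite -[d]addr0 => -> //.
    by rewrite addr0.
  by move=> b y Hy; rewrite -OH Hy lfZ addr0.
have [r -> rP] := vodd; rewrite linear_sum big_seq big1 // => x /rP[xo Hx].
by apply: (pi0 d x.1) Hx; apply: contraNneq ev => <-.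
Qed.

End Sl2Decomposition.

(** * Nullstellensatz and derivations *)

Section RealsUncountable.
Variable R : realType.

(** Cantor's nested intervals: stage n keeps a closed subinterval without the point coded n (the
    first or last third when there is such a point), so the supremum of the left ends has no
    code. *)
Lemma reals_uncountable : ~ countable [set: R].
Proof.
move/countable_injP=> [c cinj].
have {cinj}cinj : injective c by move=> x y; apply: cinj; rewrite inE.
pose P n (I : R * R) := forall x, I.1 <= x <= I.2 -> c x != n.
have step n (I : R * R) : I.1 < I.2 ->
    exists J : R * R, [/\ J.1 < J.2, I.1 <= J.1, J.2 <= I.2 & P n J].
  case: I => a b /= ab; pose d := (b - a) / 3.
  have d0 : 0 < d by rewrite divr_gt0 ?subr_gt0.
  have dE : b = a + d + d + d by rewrite /d; field.
  have [x0 [cx0|]] : exists x0, c x0 = n \/ ~ exists x, c x = n.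
    by have [[x cx]|] := pselect (exists x, c x = n); [exists x; left|exists 0; right].
  - have uniq_x x : c x == n -> x = x0 by move/eqP; rewrite -cx0 => /cinj.
    have [x0d|x0d] := ltP x0 (a + d + d).
      exists (a + d + d, b); split=> /=; [lra | lra | lra |].
      by move=> x /= /andP[x1 x2]; apply/negP => /uniq_x xE; move: x1; rewrite xE; lra.
    exists (a, a + d); split=> /=; [lra | lra | lra |].
    by move=> x /= /andP[x1 x2]; apply/negP => /uniq_x xE; move: x2; rewrite xE; lra.
  move=> nx; exists (a, b); split=> //= x _; apply/eqP => cx; apply: nx.
  by exists x.
have [J JP] : {J : nat -> R * R -> R * R | forall n I, I.1 < I.2 ->
    [/\ (J n I).1 < (J n I).2, I.1 <= (J n I).1, (J n I).2 <= I.2 & P n (J n I)]}.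
  apply: cid; have /choice[J JP] : forall x : nat * (R * R), exists K : R * R, x.2.1 < x.2.2 ->
      [/\ K.1 < K.2, x.2.1 <= K.1, K.2 <= x.2.2 & P x.1 K].
    case=> n I; have [I0|I0] := boolP (I.1 < I.2); last by exists I.
    by have [K KP] := step n I I0; exists K.
  by exists (fun n I => J (n, I)) => n I; apply: (JP (n, I)).
pose s := fix s n := if n is n'.+1 then J n' (s n') else (0, 1).
have s0 n : (s n).1 < (s n).2 by elim: n => [|n IH] /=; [exact: ltr01 | case: (JP n _ IH)].
have smono m n : (m <= n)%N -> (s m).1 <= (s n).1 /\ (s n).2 <= (s m).2.
  elim: n => [|n IH]; first by rewrite leqn0 => /eqP->.
  rewrite leq_eqVlt => /predU1P[->//|/IH[l r]]; have [_ l' r' _] := JP n _ (s0 n).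
  by split; [apply: le_trans l l' | apply: le_trans r' r].
pose A := (range (fun n => (s n).1))%classic.
have ubA n : ubound A (s n).2.
  move=> _ [m _ <-]; have [/smono[l _]|/ltnW/smono[_ r]] := leqP m n.
    by rewrite (le_trans l) // ltW.
  by rewrite (le_trans _ r) // ltW.
have supA : has_sup A by split; [exists 0, 0%N | exists 1; apply: (ubA 0%N)].
have [_ _ _ /(_ (sup A))] := JP (c (sup A)) _ (s0 (c (sup A))).
move=> h; suff /h : (s (c (sup A)).+1).1 <= sup A <= (s (c (sup A)).+1).2.
  by rewrite eqxx.
apply/andP; split.
  by apply: (ub_le_sup supA.2); exists (c (sup A)).+1.
exact: (ge_sup supA.1 (ubA _)).
Qed.

End RealsUncountable.

Lemma mpoly_alg_ind (R : comNzRingType) n (P : {mpoly R[n]} -> Prop) :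
  (forall c, P c%:MP) -> (forall i, P 'X_i) ->
  (forall p q, P p -> P q -> P (p + q)) -> (forall p q, P p -> P q -> P (p * q)) ->
  forall p, P p.
Proof.
move=> PC PX PD PM p; rewrite (mpolyE p); elim/big_ind: _ => // [|m _].
  by rewrite -(mpolyC0 n); apply: PC.
rewrite -mul_mpolyC; apply: (PM) => //; rewrite mpolyXE_id.
elim/big_ind: _ => [|p1 p2|i _]; [by rewrite -(mpolyC1 n) | exact: PM |].
by elim: (m i) => [|k IH]; rewrite ?expr0 ?exprS -?(mpolyC1 n); auto.
Qed.

(** * The Nullstellensatz over an uncountable field *)

Section Nullstellensatz.
Variables (F : closedFieldType) (n : nat).
Hypothesis F_uncountable : ~ countable [set: F].
Implicit Types (p q s : {mpoly F[n]}) (I J : set {mpoly F[n]}).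

Definition is_ideal I :=
  [/\ I 0, forall p q, I p -> I q -> I (p + q) & forall p q, I q -> I (p * q)].

Definition avoids s I := forall k, ~ I (s ^+ k).

Lemma maximal_avoiding_ideal s I : is_ideal I -> avoids s I ->
  exists M, [/\ is_ideal M, (I `<=` M)%classic, avoids s M &
    forall p, ~ M p -> exists q k, M (s ^+ k - q * p)].
Proof.
move=> Iid Is; pose good J := [/\ is_ideal J, (I `<=` J)%classic & avoids s J].
have [|M [[M0|[Mid IM Ms]] Mmax]] := @Zorn_bigcup _ (fun J => J = set0 \/ good J).
- move=> C CP Ctot; have [C0|/set0P[p [J0 CJ0 J0p]]] := eqVneq (\bigcup_(X in C) X)%classic set0.
    by left.
  have gC J q : C J -> J q -> good J by move=> CJ Jq; have [J_0|//] := CP _ CJ; rewrite J_0 in Jq.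
  right; split; first split.
  + by exists J0 => //; case: (gC _ _ CJ0 J0p) => -[].
  + move=> a b [Ja CJa Jaa] [Jb CJb Jbb].
    have [[_ aD _] _ _] := gC _ _ CJa Jaa; have [[_ bD _] _ _] := gC _ _ CJb Jbb.
    have [sab|sba] := Ctot _ _ CJa CJb.
      by exists Jb => //; apply: bD => //; apply: sab.
    by exists Ja => //; apply: aD => //; apply: sba.
  + by move=> a b [J CJ Jb]; exists J => //; case: (gC _ _ CJ Jb) => -[_ _ h] _ _; apply: h.
  + by move=> a Ia; exists J0 => //; case: (gC _ _ CJ0 J0p) => _ h _; apply: h.
  + by move=> k [J CJ Jk]; case: (gC _ _ CJ Jk) => _ _ /(_ k).
- case: (Mmax I); last by right; split.
  by rewrite M0; split=> [p []|I0]; case: Iid => /I0.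
exists M; split=> // p Mp; have [M0 MD MM] := Mid.
pose J := [set r | exists2 q, True & M (r - q * p)]%classic.
have nJ : ~ good J.
  move=> gJ; apply: (Mmax J); last by right.
  split=> [r Mr|JM]; first by exists 0 => //; rewrite mul0r subr0.
  by apply: Mp; apply: JM; exists 1 => //; rewrite mul1r subrr.
apply: contrapT => nE; apply: nJ; split; first split.
- by exists 0 => //; rewrite mul0r subr0.
- move=> a b [q _ Mq] [r _ Mr]; exists (q + r) => //.
  by rewrite mulrDl opprD addrACA; apply: MD.
- by move=> a b [q _ Mq]; exists (a * q) => //; rewrite -mulrA -mulrBr; apply: MM.
- by move=> r Ir; exists 0 => //; rewrite mul0r subr0; apply: IM.
- by move=> k [q _ Mq]; apply: nE; exists q, k.
Qed.

Lemma infinite_fiber (U : countType) (h : F -> U) :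
  exists2 x, True & infinite_set [set a | h a = x]%classic.
Proof.
apply: contrapT => nE; apply: F_uncountable.
have -> : [set: F]%classic = (\bigcup_(x in [set: U]) [set a | h a = x])%classic.
  by apply/seteqP; split=> // a _; exists (h a).
apply: bigcup_countable => // x _; apply: finite_set_countable.
by apply: contrapT => inf; apply: nE; exists x.
Qed.

Lemma mpoly_dependent D (f : nat -> {mpoly F[n]}) :
  (forall i, msize (f i) <= D)%N -> exists r (b : 'I_r -> F),
    (exists i, b i != 0) /\ \sum_i b i *: f i = 0.
Proof.
move=> fD; pose T : finType := bmultinom n D; pose r := #|T|.+1.
pose A : 'M[F]_(r, #|T|) := \matrix_(i, j) (f i)@_(enum_val j : T).
have : kermx A != 0.
  rewrite kermx_eq0 /row_free neq_ltn; apply/orP; left.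
  by rewrite (leq_ltn_trans (rank_leq_col A)).
case/rowV0Pn => v /sub_kermxP vA v0; exists r, (v 0); split.
  by have /rV0Pn := v0.
apply/mpolyP => m; rewrite raddf_sum mcoeff0 /=.
have [mD|mD] := ltnP (mdeg m) D.
  have := congr1 (fun B : 'rV_#|T| => B 0 (enum_rank (BMultinom mD))) vA.
  rewrite !mxE => vA0; rewrite -[RHS]vA0; apply: eq_bigr => i _.
  by rewrite mxE enum_rankK mcoeffZ.
rewrite big1 // => i _; rewrite mcoeffZ memN_msupp_eq0 ?mulr0 //.
by apply: msize_mdeg_ge; rewrite (leq_trans (fD i)).
Qed.

(* Modulo an ideal M maximal among those avoiding the powers of s, every L - a
   outside M divides a power of s; as F is uncountable, infinitely many of the
   cofactors have the same degree, hence are linearly dependent, and clearing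
   denominators puts a product of factors L - a in M. *)
Lemma nullstellensatz s I : is_ideal I -> avoids s I ->
  exists2 a : 'I_n -> F, forall p, I p -> p.@[a] = 0 & s.@[a] != 0.
Proof.
move=> Iid Is; have [M [Mid IM Ms Mmax]] := maximal_avoiding_ideal Iid Is.
have [M0 MD MM] := Mid.
have prime t k (L : {mpoly F[n]}) : (forall a, ~ M (L - a%:MP)) ->
    ~ M (s ^+ k * \prod_(a <- t) (L - a%:MP)).
  move=> nM; elim: t k => [|a t IH] k; first by rewrite big_nil mulr1; apply: Ms.
  have [q [j Mj]] := Mmax _ (nM a); rewrite big_cons => Mk; apply: (IH (k + j)%N).
  have -> : s ^+ (k + j) * \prod_(a0 <- t) (L - a0%:MP) =
    q * (s ^+ k * ((L - a%:MP) * \prod_(a0 <- t) (L - a0%:MP))) +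
    (s ^+ k * \prod_(a0 <- t) (L - a0%:MP)) * (s ^+ j - q * (L - a%:MP)).
    by rewrite exprD; ring.
  by apply: MD; apply: MM.
have Ma L : exists a, M (L - a%:MP).
  apply: contrapT => nE; have nM a : ~ M (L - a%:MP) by move=> Ma; apply: nE; exists a.
  have /choice[q qP] : forall a, exists q : {mpoly F[n]} * nat, M (s ^+ q.2 - q.1 * (L - a%:MP)).
    by move=> a; have [q [k qk]] := Mmax _ (nM a); exists (q, k).
  have [[D k] _ inf] := infinite_fiber (fun a => (msize (q a).1, (q a).2)).
  have /infiniteP/card_leP[g0] := inf.
  pose g (i : nat) : F := val (g0 (SigSub (in_setT i))).
  have gP i : msize (q (g i)).1 = D /\ (q (g i)).2 = k.
    by have := set_mem (valP (g0 (SigSub (in_setT i)))); case.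
  have ginj : injective g.
    move=> i j /val_inj g0E; have /(congr1 val) := inj (in_setT _) (in_setT _) g0E.
    by [].
  have [|r [b [[l0 bj] bq]]] := @mpoly_dependent D (fun i => (q (g i)).1).
    by move=> i; rewrite (gP i).1.
  (* The numerator of the sum of b_i / (X - g_i). Modulo M, the cofactor q_i stands for s^k / (L -
     g_i), so the linear relation puts s^k G(L) in M. *)
  pose G : {poly F} := \sum_(i < r) b i *: \prod_(l < r | l != i) ('X - (g l)%:P).
  have G0 : G != 0.
    apply: contraNneq bj => G0; have := congr1 (fun x : {poly F} => x.[g l0]) G0.
    rewrite horner0 horner_sum (bigD1 l0) //= [X in _ + X]big1 ?addr0 => [|i ij].
      rewrite hornerZ horner_prod => /eqP; rewrite mulf_eq0 => /orP[//|].
      case/prodf_eq0 => l lj; rewrite hornerXsubC subr_eq0 => /eqP/ginj/val_inj ljE.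
      by rewrite ljE eqxx in lj.
    rewrite hornerZ horner_prod (bigD1 l0) /= 1?eq_sym // hornerXsubC subrr mul0r mulr0 //.
  pose ev (p : {poly F}) := (map_poly (@mpolyC n F) p).[L].
  have evX a : ev ('X - a%:P) = L - a%:MP.
    by rewrite /ev rmorphB /= map_polyX map_polyC hornerXsubC.
  have MG : M (s ^+ k * ev G).
    have evG : ev G = \sum_(i < r) (b i)%:MP * \prod_(l < r | l != i) (L - (g l)%:MP).
      rewrite /ev rmorph_sum horner_sum; apply: eq_bigr => i _.
      rewrite -mul_polyC rmorphM /= map_polyC hornerM hornerC rmorph_prod horner_prod /=.
      by congr (_ * _); apply: eq_bigr => l _; rewrite -/(ev _) evX.
    have -> : s ^+ k * ev G = \sum_(i < r) ((b i)%:MP * \prod_(l < r | l != i) (L - (g l)%:MP)) *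
        (s ^+ k - (q (g i)).1 * (L - (g i)%:MP)) +
        \prod_(l < r) (L - (g l)%:MP) * \sum_(i < r) b i *: (q (g i)).1.
      rewrite mulr_sumr -big_split evG mulr_sumr; apply: eq_bigr => i _ /=.
      have -> : \prod_(l < r) (L - (g l)%:MP) =
        (L - (g i)%:MP) * \prod_(l < r | l != i) (L - (g l)%:MP) by rewrite (bigD1 i).
      by rewrite -mul_mpolyC; ring.
    apply: (MD); last by rewrite bq mulr0.
    elim/big_ind: _ => // i _; apply: MM.
    by have := qP (g i); rewrite (gP i).2.
  have [t tE] := closed_field_poly_normal G.
  apply: (prime t k L nM); have lc : lead_coef G != 0 by rewrite lead_coef_eq0.
  have -> : s ^+ k * \prod_(a <- t) (L - a%:MP) = ((lead_coef G)^-1)%:MP * (s ^+ k * ev G).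
    rewrite [in ev G]tE /ev -mul_polyC rmorphM /= map_polyC hornerM hornerC.
    rewrite rmorph_prod horner_prod /= [RHS]mulrCA; congr (_ * _).
    rewrite mulrA -mpolyCM mulVf // mpolyC1 mul1r.
    by apply: eq_bigr => a _; rewrite -evX.
  exact: MM.
have /choice[a aP] : forall i : 'I_n, exists a, M ('X_i - a%:MP) by move=> i; apply: Ma.
have red p : M (p - (p.@[a])%:MP).
  elim/mpoly_alg_ind: p => [c|i|p q Mp Mq|p q Mp Mq].
  - by rewrite mevalC subrr.
  - by rewrite mevalXU.
  - by rewrite mevalD mpolyCD opprD addrACA; apply: (MD).
  - have -> : p * q - (p * q).@[a]%:MP =
      p * (q - q.@[a]%:MP) + q.@[a]%:MP * (p - p.@[a]%:MP) by rewrite mevalM mpolyCM; ring.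
    by apply: (MD); apply: (MM).
have vanish p : M p -> p.@[a] = 0.
  move=> Mp; apply/eqP; apply: contraT => pa; case: (Ms 0%N).
  have -> : s ^+ 0 = (p.@[a]^-1)%:MP * (p + (-1) * (p - p.@[a]%:MP)).
    by rewrite expr0 mulN1r opprB addrCA subrr addr0 -mpolyCM mulVf // mpolyC1.
  by apply: (MM); apply: (MD) => //; apply: (MM).
exists a => [p /IM/vanish//|]; apply/eqP => sa; apply: (Ms 1%N).
by rewrite expr1; have := red s; rewrite sa mpolyC0 subr0.
Qed.

End Nullstellensatz.

Local Notation "x %:F" := (@tofrac _ x) : ring_scope.

(** * Weighted homogeneous systems with 0 as only common zero *)

Section WeightedHomogeneous.
Variables (R : comNzRingType) (n : nat) (w : 'I_n -> nat).
Implicit Types (p q : {mpoly R[n]}) (m : 'X_{1..n}).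

Definition mweight m := (\sum_(j < n) w j * m j)%N.

Lemma mweightD m1 m2 : mweight (m1 + m2)%MM = (mweight m1 + mweight m2)%N.
Proof. by rewrite -big_split; apply: eq_bigr => j _; rewrite mnmDE mulnDr. Qed.

Definition whomog e p := forall m, m \in msupp p -> mweight m = e.

(* In a weight e combination of polynomials of weight d, only this part of the
   coefficients matters. *)
Definition wpart d e p := \sum_(m <- msupp p | (mweight m + d == e)%N) p@_m *: 'X_[m].

Lemma msupp_sum_monomials (P : pred 'X_{1..n}) p m :
  m \in msupp (\sum_(k <- msupp p | P k) p@_k *: 'X_[k]) -> P m.
Proof.
move/msupp_sum_le => /flattenP[x /mapP[k]]; rewrite mem_filter => /andP[Pk _] ->{x}.
by move/msuppZ_le; rewrite msuppX inE => /eqP->.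
Qed.

Lemma wpart_mul d e p q : whomog d q -> forall m,
  (wpart d e p * q)@_m = if mweight m == e then (p * q)@_m else 0.
Proof.
move=> hq m; have [me|me] := eqVneq (mweight m) e; last first.
  apply: memN_msupp_eq0; apply: contraNN me => /msuppM_le/allpairsP[[a b] /= [ap bq ->]].
  by rewrite mweightD (hq b) //; apply: (msupp_sum_monomials ap).
rewrite {2}(mpolyE p) (bigID (fun k => mweight k + d == e)%N) /= -/(wpart d e p).
rewrite mulrDl mcoeffD [X in _ + X]memN_msupp_eq0 ?addr0 //.
apply/negP => /msuppM_le/allpairsP[[a b] /= [/msupp_sum_monomials ap bq mE]].
by move: ap; rewrite -me mE mweightD (hq b) // eqxx.
Qed.

Lemma whomog_ideal k (c r : 'I_k -> {mpoly R[n]}) (d : 'I_k -> nat) e p :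
    (forall i, whomog (d i) (c i)) -> whomog e p -> p = \sum_i r i * c i ->
  p = \sum_i wpart (d i) e (r i) * c i.
Proof.
move=> hc hp pE; apply/mpolyP => m; have [me|me] := eqVneq (mweight m) e.
  rewrite {1}pE !raddf_sum /=; apply: eq_bigr => i _.
  by rewrite (wpart_mul _ _ (hc i)) me eqxx.
rewrite memN_msupp_eq0; last by apply: contraNN me => /hp->.
rewrite raddf_sum big1 // => i _ /=.
by rewrite (wpart_mul _ _ (hc i)) (negPf me).
Qed.

End WeightedHomogeneous.

Section FiniteExtension.
Variables (F : closedFieldType) (n k : nat) (w : 'I_n -> nat).
Variables (c : 'I_k -> {mpoly F[n]}) (d : 'I_k -> nat).
Hypothesis F_uncountable : ~ countable [set: F].
Hypothesis d_gt0 : forall i, (0 < d i)%N.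
Hypothesis c_homog : forall i, whomog w (d i) (c i).
Hypothesis c_zero : forall a : 'I_n -> F, (forall i, (c i).@[a] = 0) -> forall j, a j = 0.

Let phi (p : {mpoly F[k]}) : {mpoly F[n]} := p \mPo [tuple c i | i < k].

Lemma variable_power_in_ideal :
  exists M, forall j, exists r, 'X_j ^+ M = \sum_i r i * c i.
Proof.
pose I : set {mpoly F[n]} := [set p | exists r, p = \sum_i r i * c i]%classic.
have I0 : is_ideal I.
  split=> [|p q [r ->] [s ->]|p q [r ->]].
  - by exists (fun=> 0); rewrite big1 // => i _; rewrite mul0r.
  - by exists (fun i => r i + s i); rewrite -big_split; apply: eq_bigr => i _; rewrite mulrDl.
  - by exists (fun i => p * r i); rewrite mulr_sumr; apply: eq_bigr => i _; rewrite mulrA.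
have [_ _ IM] := I0.
have Ij j : exists M, I ('X_j ^+ M).
  apply: contrapT => nE; have [|a aI] := nullstellensatz F_uncountable I0 (s := 'X_j).
    by move=> M IM'; apply: nE; exists M.
  rewrite mevalXU c_zero ?eqxx // => i; apply: aI; exists (fun l => (l == i)%:R).
  rewrite (bigD1 i) //= eqxx mul1r big1 ?addr0 // => l /negPf->.
  by rewrite mul0r.
have /choice[M MP] := Ij; exists (\sum_j M j)%N => j.
rewrite (bigD1 j) //= addnC exprD; exact: IM.
Qed.

(** The monomials with all exponents at most M generate. Any other monomial lies in the ideal of the
    c_i, with coefficients that can be taken homogeneous of weight smaller by d_i > 0: induction on
    the weight applies. *)
Lemma finite_over_invariants : exists r (b : 'I_r -> {mpoly F[n]}),
  (exists i, b i = 1) /\ forall p, exists a : 'I_r -> {mpoly F[k]}, p = \sum_i phi (a i) * b i.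
Proof.
have [M MP] := variable_power_in_ideal.
pose T : finType := {ffun 'I_n -> 'I_M.+1}; pose b (i : 'I_#|T|) : {mpoly F[n]} :=
  'X_[[multinom (enum_val i j : nat) | j < n]].
exists #|T|, b; split.
  exists (enum_rank [ffun=> ord0]); rewrite /b -mpolyX0; congr 'X_[_].
  by apply/mnmP => j; rewrite !mnmE enum_rankK ffunE.
pose Sp p := exists a : 'I_#|T| -> {mpoly F[k]}, p = \sum_i phi (a i) * b i.
have SpD p q : Sp p -> Sp q -> Sp (p + q).
  move=> [r ->] [s ->]; exists (fun i => r i + s i).
  by rewrite -big_split; apply: eq_bigr => i _; rewrite /phi rmorphD mulrDl.
have SpM a p : Sp p -> Sp (phi a * p).
  move=> [r ->]; exists (fun i => a * r i); rewrite mulr_sumr.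
  by apply: eq_bigr => i _; rewrite /phi rmorphM mulrA.
have Sp0 : Sp 0 by exists (fun=> 0); rewrite big1 // => i _; rewrite /phi rmorph0 mul0r.
have SpZ (a : F) p : Sp p -> Sp (a *: p).
  by move=> /(SpM a%:MP); rewrite /phi comp_mpolyC mul_mpolyC.
have Spm e m : (mweight w m < e)%N -> Sp 'X_[m].
  elim: e m => [//|e IH] m me; have [/forallP mM|] := boolP [forall j, m j < M.+1]%N.
    pose t : T := [ffun j => Ordinal (mM j)].
    exists (fun i => (i == enum_rank t)%:R); rewrite (bigD1 (enum_rank t)) //= big1.
      rewrite eqxx /phi rmorph1 mul1r addr0 /b; congr 'X_[_].
      by apply/mnmP => j; rewrite mnmE enum_rankK ffunE.
    by move=> i /negPf->; rewrite /phi rmorph0 mul0r.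
  rewrite negb_forall => /existsP[j]; rewrite -leqNgt => Mj.
  have [r rE] := MP j.
  have mE : 'X_[m] = \sum_i ('X_[m - U_(j) *+ M] * r i) * c i :> {mpoly F[n]}.
    under eq_bigr do rewrite -mulrA; rewrite -mulr_sumr -rE mpolyXn -mpolyXD.
    rewrite submK //; apply/mnm_lepP => l; rewrite mulmnE mnm1E.
    by have [<-|_] := eqVneq j l; rewrite ?mul1n // ltnW.
  have hX : whomog w (mweight w m) ('X_[m] : {mpoly F[n]}).
    by move=> l; rewrite msuppX inE => /eqP->.
  rewrite (whomog_ideal c_homog hX mE).
  elim/big_ind: _ => // i _; rewrite mulrC.
  have -> : c i = phi 'X_i by rewrite /phi comp_mpolyXU -tnth_nth tnth_mktuple.
  apply: (SpM); rewrite /wpart big_seq_cond; elim/big_ind: _ => // l /andP[_ /eqP lE].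
  apply: SpZ; apply: IH; move: me; rewrite -lE ltnS; apply: leq_trans.
  by rewrite -[X in (X < _)%N]addn0 ltn_add2l.
move=> p; rewrite (mpolyE p); elim/big_ind: _ => // m _.
exact/SpZ/(Spm (mweight w m).+1).
Qed.

Local Notation Q := {fraction {mpoly F[n]}}.

(** The determinant trick: over the fraction field, the row of generators is an eigenvector for p of
    the matrix of multiplication by p, nonzero because 1 is among the generators. *)
Lemma variable_integral p : exists2 q : {poly {mpoly F[k]}},
  q \is monic & (map_poly phi q).[p] = 0.
Proof.
have [r [b [[i0 bi0] bP]]] := finite_over_invariants.
have /choice[a aP] : forall i, exists a : 'I_r -> {mpoly F[k]},
    p * b i = \sum_l phi (a l) * b l by move=> i; apply: bP.
pose A : 'M[{mpoly F[k]}]_r := \matrix_(l, i) a i l.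
exists (char_poly A); first exact: char_poly_monic.
pose iota (x : {mpoly F[n]}) : Q := x%:F.
have iota0 x : iota x = 0 -> x = 0 by move/eqP; rewrite tofrac_eq0 => /eqP.
apply: (iota0).
pose psi : {mpoly F[k]} -> Q := @tofrac _ \o phi.
have : root (char_poly (map_mx (@tofrac _ \o phi) A)) (iota p).
  rewrite -eigenvalue_root_char; apply/eigenvalueP.
  exists (\row_l iota (b l)); last first.
    apply/rV0Pn; exists i0; rewrite mxE bi0; apply/eqP => /iota0/eqP.
    by rewrite oner_eq0.
  apply/rowP => i; rewrite !mxE -rmorphM aP rmorph_sum; apply: eq_bigr => l _.
  by rewrite !mxE rmorphM mulrC.
rewrite -map_char_poly map_poly_comp => /rootP.
by rewrite horner_map.
Qed.

(* A derivation killing the c_i kills everything integral over F[c]: if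
   P(x) = 0 then P'(x) Dx = 0, and one differentiates P down to a constant. *)
Lemma derivation_integral (D : {mpoly F[n]} -> Q) :
    [pchar F] =i pred0 ->
    (forall x y, D (x + y) = D x + D y) ->
    (forall x y, D (x * y) = x%:F * D y + y%:F * D x) ->
    (forall a, D a%:MP = 0) -> (forall i, D (c i) = 0) ->
  forall x, D x = 0.
Proof.
move=> F0 DD DM DC Dc x; have [P Pmon Px] := variable_integral x.
have D0 a : D (phi a) = 0.
  elim/mpoly_alg_ind: a => [a|i|p q Dp Dq|p q Dp Dq].
  - by rewrite /phi comp_mpolyC.
  - by rewrite /phi comp_mpolyXU -tnth_nth tnth_mktuple.
  - by rewrite /phi rmorphD DD Dp Dq addr0.
  - by rewrite /phi rmorphM DM Dp Dq !mulr0 addr0.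
have DP (q : {poly {mpoly F[k]}}) :
    D (map_poly phi q).[x] = ((map_poly phi q^`()).[x])%:F * D x.
  elim/poly_ind: q => [|q a IH].
    by rewrite deriv0 rmorph0 horner0 rmorph0 mul0r -(mpolyC0 n) DC.
  rewrite derivMXaddC !rmorphD !rmorphM /= !map_polyX map_polyC !hornerE /=.
  by rewrite DD DM D0 addr0 IH rmorphD rmorphM /=; ring.
apply/eqP; apply: contraT => Dx.
have Pj j : (map_poly phi P^`(j)).[x] = 0.
  elim: j => [|j IH]; first by rewrite derivn0.
  rewrite derivnS; have := DP (P^`(j)); rewrite IH -(mpolyC0 n) DC => /esym/eqP.
  by rewrite mulf_eq0 (negPf Dx) orbF tofrac_eq0 mpolyC0 => /eqP.
have szP : (0 < size P)%N by rewrite size_poly_gt0 monic_neq0.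
have PE : P^`((size P).-1) = ((size P).-1`!%:R)%:P.
  apply/polyP => i; rewrite coef_derivn coefC; case: i => [|i].
    by rewrite addn0 -lead_coefE (monicP Pmon) ffactnn.
  by rewrite nth_default ?mul0rn // addnS -[X in (X <= _)%N](prednK szP) ltnS leq_addr.
have := Pj (size P).-1; rewrite PE.
rewrite [map_poly _ _](map_polyC (comp_mpoly [tuple c i | i < k])) hornerC /= rmorph_nat => /eqP.
rewrite -(rmorph_nat (@mpolyC n F)) mpolyC_eq0.
have := F0; rewrite pcharf0P => -> ; rewrite eqn0Ngt fact_gt0 //.
Qed.

End FiniteExtension.

(** Otherwise [derivation_integral] applies to the derivation with components v_j, whose value at
    X_j is v_j. *)
Lemma nontrivial_zero (F : closedFieldType) n k (w : 'I_n -> nat)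
    (c : 'I_k -> {mpoly F[n]}) (d : 'I_k -> nat)
    (v : 'I_n -> {fraction {mpoly F[n]}}) :
    ~ countable [set: F] -> [pchar F] =i pred0 ->
    (forall i, (0 < d i)%N) -> (forall i, whomog w (d i) (c i)) ->
    (forall i, \sum_j v j * ((c i)^`M(j))%:F = 0) -> (exists j, v j != 0) ->
  exists a : 'I_n -> F, (forall i, (c i).@[a] = 0) /\ exists j, a j != 0.
Proof.
move=> Func F0 d0 hc Dc [j vj]; apply: contrapT => nE.
have c0 (a : 'I_n -> F) : (forall i, (c i).@[a] = 0) -> forall j, a j = 0.
  move=> ca l; apply/eqP; apply: contraT => al; case: nE.
  by exists a; split=> //; exists l.
pose D (x : {mpoly F[n]}) := \sum_j v j * (x^`M(j))%:F.
have D0 : forall x, D x = 0.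
  apply: (derivation_integral Func d0 hc c0) => // [x y|x y|a].
  - rewrite -big_split; apply: eq_bigr => l _.
    by rewrite mderivD rmorphD mulrDr.
  - rewrite !mulr_sumr -big_split; apply: eq_bigr => l _ /=.
    by rewrite mderivM rmorphD !rmorphM /=; ring.
  - by apply: big1 => l _; rewrite mderivC rmorph0 mulr0.
have := D0 'X_j; rewrite /D (bigD1 j) //= big1 ?addr0 => [|l lj]; last first.
  by rewrite mderivX mnm1E eq_sym (negPf lj) scale0r rmorph0 mulr0.
have -> : ('X_j : {mpoly F[n]})^`M(j) = 1.
  rewrite mderivX mnm1E eqxx scale1r -mpolyX0; congr 'X_[_].
  by apply/mnmP => i; rewrite mnmBE subnn mnm0E.
by rewrite rmorph1 mulr1 => /eqP; rewrite (negPf vj).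
Qed.

(** * Slices *)

Section GenericRank.
Variables (F : fieldType) (B : comNzRingType).
Variables (inc : {rmorphism F -> B}) (ev0 : {rmorphism B -> F}).
Hypothesis incK : cancel inc ev0.

(* The polynomial delta is a maximal nonzero minor of A after base change. *)
Lemma rank_generic m n (A : 'M[B]_(m, n)) : exists2 delta, ev0 delta != 0 &
  forall (F' : fieldType) (ev1 : {rmorphism B -> F'}), ev1 delta != 0 ->
    (\rank (map_mx ev0 A) <= \rank (map_mx ev1 A))%N.
Proof.
set A0 := map_mx ev0 A; have /row_fullP[P cP] := col_base_full A0.
have /row_freeP[Q rQ] := row_base_free A0.
pose S := map_mx inc P *m A *m map_mx inc Q.
have mapK m' n' (M : 'M[F]_(m', n')) : map_mx ev0 (map_mx inc M) = M.
  by apply/matrixP => i j; rewrite !mxE incK.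
exists (\det S).
  have PQ : P *m A0 *m Q = 1%:M.
    by rewrite -[X in _ *m X *m _](mulmx_base A0) (mulmxA P) cP mul1mx rQ.
  by rewrite -det_map_mx !map_mxM !mapK -/A0 PQ det1 oner_eq0.
move=> F' ev1; rewrite -det_map_mx -unitfE -unitmxE -row_free_unit.
move/eqP => <-; rewrite !map_mxM.
by rewrite (leq_trans (mxrankM_maxl _ _)) // mxrankM_maxr.
Qed.

End GenericRank.

Section MatrixDerivation.
Variables (B S : comNzRingType) (iota : {rmorphism B -> S}) (D : B -> S).
Hypothesis DD : forall x y, D (x + y) = D x + D y.
Hypothesis DM : forall x y, D (x * y) = iota x * D y + iota y * D x.

Let D0 : D 0 = 0.
Proof. by apply: (addrI (D 0)); rewrite -DD !addr0. Qed.

Let D_sum I r (P : pred I) (E : I -> B) :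
  D (\sum_(i <- r | P i) E i) = \sum_(i <- r | P i) D (E i).
Proof. exact: (big_morph D DD D0). Qed.

Lemma derivation_mulmx m n p (X : 'M[B]_(m, n)) (Y : 'M[B]_(n, p)) :
  map_mx D (X *m Y) = map_mx iota X *m map_mx D Y + map_mx D X *m map_mx iota Y.
Proof.
apply/matrixP => i j; rewrite !mxE D_sum -big_split; apply: eq_bigr => k _ /=.
by rewrite !mxE DM; congr (_ + _); rewrite mulrC.
Qed.

(* A D-equation A' = alpha A + [A, Z] is inherited by the powers of A, and
   commutators have trace 0. *)
Lemma derivation_trace_expr n (A : 'M[B]_n) (Z : 'M[S]_n) (alpha : S) k :
    map_mx D A = alpha *: map_mx iota A +
      (map_mx iota A *m Z - Z *m map_mx iota A) ->
  D (\tr (A ^+ k.+1)) = k.+1%:R * alpha * iota (\tr (A ^+ k.+1)).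
Proof.
move=> DA; set a := map_mx iota A in DA.
have mE (T : comNzRingType) (X Y : 'M[T]_n) : X * Y = X *m Y by [].
have aE j : map_mx iota (A ^+ j.+1) = a ^+ j.+1.
  by elim: j => [//|j IH]; rewrite exprS mE map_mxM IH -/a -mE -exprS.
have DAk j : map_mx D (A ^+ j.+1) =
    (j.+1%:R * alpha) *: a ^+ j.+1 + (a ^+ j.+1 *m Z - Z *m a ^+ j.+1).
  elim: j => [|j IH]; first by rewrite mul1r.
  rewrite exprS [A * _]mE derivation_mulmx IH DA aE -/a [a ^+ j.+2]exprS mE.
  rewrite mulmxDr mulmxBr mulmxDl mulmxBl -scalemxAr -scalemxAl !mulmxA.
  rewrite -[j.+2%:R]natr1 mulrDl mul1r scalerDl.
  by rewrite addrACA; congr (_ + _); rewrite subrKA.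
have trD (X : 'M[B]_n) : D (\tr X) = \tr (map_mx D X).
  by rewrite D_sum; apply: eq_bigr => i _; rewrite mxE.
rewrite trD DAk mxtraceD linearB /= [\tr (Z *m _)]mxtrace_mulC subrr addr0.
by rewrite mxtraceZ -aE trace_map_mx.
Qed.

End MatrixDerivation.

Section VspaceMatrix.
Variables (F : fieldType) (V : vectType F).

Lemma memv_v2r (v : V) (U : {vspace V}) : (v \in U) = (v2r v <= vs2mx U)%MS.
Proof. by rewrite -[LHS]/(_ <= _)%MS /= genmxE. Qed.

Lemma dimv_img_mx (f : 'End(V)) (U : {vspace V}) :
  \dim (f @: U) = \rank (vs2mx U *m f2mx f).
Proof. by rewrite unlock /dimv /= genmxE. Qed.

End VspaceMatrix.

(** * The slice and its trace functions *)

Section Slice.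
Variables (F : numClosedFieldType) (V : vectType F) (br : lie_bracket V).
Variables (e h : V) (N : nat) (b : 'I_N -> V) (dd : 'I_N -> nat).
Hypothesis he : br h e = 2 *: e.
Hypothesis hb : forall j, br h (b j) = - (dd j)%:R *: b j.

Definition slice (a : 'I_N -> F) : V := e + \sum_j a j *: b j.

(** The torus of h, rescaled so as to fix e of weight 2, multiplies b_j of weight - dd j by t^(dd j
    + 2). *)
Definition slice_weight (j : 'I_N) : nat := (dd j + 2)%N.

Local Notation n := (dim V).
Local Notation B := {mpoly F[N]}.
Local Notation M x := (f2mx (ad br x)).
Local Notation C := (map_mx (@mpolyC N F)).

Definition slice_mx : 'M[B]_n := C (M e) + \sum_j 'X_j *: C (M (b j)).

Definition slice_inv (i : nat) : B := \tr (slice_mx ^+ i.+1).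

Lemma map_mxX (R S : comNzRingType) (f : {rmorphism R -> S}) m (A : 'M[R]_m) k :
  map_mx f (A ^+ k) = map_mx f A ^+ k.
Proof.
elim: k => [|k IH]; first exact: map_mx1.
by rewrite !exprS -IH; apply: map_mxM.
Qed.

Lemma slice_mx_eval a : map_mx (meval a) slice_mx = M (slice a).
Proof.
apply/matrixP => i j; rewrite /slice linearD linear_sum linearD linear_sum /=.
rewrite !mxE mevalD mevalC !summxE raddf_sum; congr (_ + _); apply: eq_bigr => l _ /=.
by rewrite linearZ linearZ /= !mxE mevalM mevalXU mevalC.
Qed.

Lemma slice_inv_eval i a : (slice_inv i).@[a] = \tr (M (slice a) ^+ i.+1).
Proof. by rewrite -slice_mx_eval -map_mxX trace_map_mx. Qed.

(** The order is reversed because matrices act on row vectors. *)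
Lemma M_br x y : M (br x y) = M y *m M x - M x *m M y.
Proof. by rewrite ad_br linearB /= !f2mx_comp. Qed.

Let w := slice_weight.

Definition euler (p : B) : B := \sum_j (w j)%:R *: ('X_j * p^`M(j)).

Lemma eulerD p q : euler (p + q) = euler p + euler q.
Proof.
rewrite -big_split; apply: eq_bigr => j _.
by rewrite mderivD mulrDr scalerDr.
Qed.

Lemma eulerM p q : euler (p * q) = p * euler q + q * euler p.
Proof.
rewrite !mulr_sumr -big_split; apply: eq_bigr => j _ /=.
by rewrite mderivM -!mul_mpolyC; ring.
Qed.

Lemma eulerC a : euler a%:MP = 0.
Proof. by apply: big1 => j _; rewrite mderivC mulr0 scaler0. Qed.

Lemma mcoeff_euler p m : (euler p)@_m = (mweight w m)%:R * p@_m.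
Proof.
have eX k : euler 'X_[k] = (mweight w k)%:R *: 'X_[k].
  rewrite /euler /mweight natr_sum scaler_suml; apply: eq_bigr => j _.
  rewrite mderivX -scalerAr scalerA -natrM.
  have [kj0|kj0] := eqVneq (k j) 0%N; first by rewrite kj0 muln0 !scale0r.
  by rewrite -mpolyXD addmC submK // lep1mP.
elim/mpolyind: p => [|c k p _ _ IH].
  by rewrite -(mpolyC0 N) eulerC !mcoeffC mul0r mulr0.
rewrite eulerD !mcoeffD IH -mul_mpolyC eulerM eulerC mulr0 addr0 eX.
rewrite !mul_mpolyC !mcoeffZ mcoeffX mulrDr; congr (_ + _).
by have [->|_] := eqVneq k m; rewrite ?mulr0 ?mulr1 // mulrC.
Qed.

(** The weighted Euler field at a point x of the slice is 2 x - [h, x]: the component e contributes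
    0 and b_j the factor dd j + 2. *)
Lemma euler_slice_mx :
  map_mx euler slice_mx = 2 *: slice_mx + (slice_mx *m - C (M h) - - C (M h) *m slice_mx).
Proof.
have He : M e *m M h - M h *m M e = 2 *: M e by rewrite -M_br he !linearZ.
have Hb j : M (b j) *m M h - M h *m M (b j) = - (dd j)%:R *: M (b j).
  by rewrite -M_br hb !linearZ.
have Cc x : C (M x) *m C (M h) - C (M h) *m C (M x) = C (M x *m M h - M h *m M x).
  by rewrite map_mxB !map_mxM.
have -> : slice_mx *m - C (M h) - - C (M h) *m slice_mx =
    - (C (2 *: M e) + \sum_j 'X_j *: C (- (dd j)%:R *: M (b j))).
  rewrite mulNmx opprK mulmxN addrC -opprB; congr (- _).
  rewrite /slice_mx mulmxDl mulmxDr opprD addrACA Cc He; congr (_ + _).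
  rewrite mulmx_suml mulmx_sumr -sumrB; apply: eq_bigr => j _.
  by rewrite -scalemxAl -scalemxAr -scalerBr Cc Hb.
apply/matrixP => i j; rewrite !mxE !summxE.
have e0 : euler 0 = 0 by rewrite -(mpolyC0 N) eulerC.
have esum (I : finType) (E : I -> B) : euler (\sum_i E i) = \sum_i euler (E i).
  exact: (big_morph _ eulerD e0).
rewrite eulerD eulerC add0r esum mulrDr opprD addrACA mpolyCM.
have -> : 2 * (M e i j)%:MP - 2%:MP * (M e i j)%:MP = 0 :> B.
  by rewrite -[2]/(2%:R) -(rmorph_nat (@mpolyC N F)) subrr.
rewrite add0r mulr_sumr -sumrB; apply: eq_bigr => l _.
rewrite !mxE eulerM eulerC mulr0 add0r.
have -> : euler 'X_l = (w l)%:R *: 'X_l.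
  apply/mpolyP => m; rewrite mcoeff_euler mcoeffZ mcoeffX.
  have [<-|_] := eqVneq U_(l)%MM m; rewrite ?mulr0 // !mulr1; congr _%:R.
  rewrite /mweight (bigD1 l) //= mnm1E eqxx muln1 big1 ?addn0 // => k kl.
  by rewrite mnm1E eq_sym (negPf kl) muln0.
have C2 : 2%:MP = 2 :> B := rmorph_nat (@mpolyC N F) 2.
by rewrite -mul_mpolyC /w /slice_weight natrD (mpolyCD N _ 2) !mpolyCM mpolyCN C2; ring.
Qed.

(** The commutator in [euler_slice_mx] disappears under the trace, so the function is an eigenvector
    of the Euler operator, which multiplies each monomial by its weight. *)
Lemma slice_inv_whomog i : whomog w (2 * i.+1)%N (slice_inv i).
Proof.
move=> m mS; have idE : map_mx (idfun : B -> B) slice_mx = slice_mx.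
  by apply/matrixP => j k; rewrite mxE.
have := @derivation_trace_expr B B idfun euler eulerD eulerM n slice_mx (- C (M h)) 2 i.
rewrite [map_mx idfun _]idE => /(_ euler_slice_mx).
move/(congr1 (mcoeff m)); rewrite mcoeff_euler -/(slice_inv i) /=.
have -> : i.+1%:R * 2 = ((2 * i.+1)%N%:R : F)%:MP :> B.
  by rewrite rmorph_nat natrM mulrC.
rewrite mul_mpolyC mcoeffZ => /mulIf; rewrite mcoeff_msupp in mS.
by move=> /(_ mS)/eqP; rewrite eqr_nat => /eqP.
Qed.

Lemma slice_inv_scale i a (t : F) : (slice_inv i).@[a] = 0 ->
  (slice_inv i).@[fun j => t ^+ w j * a j] = 0.
Proof.
move=> ia; rewrite -[RHS](mulr0 (t ^+ (2 * i.+1))) -ia !mevalE mulr_sumr.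
rewrite !big_seq; apply: eq_bigr => m /slice_inv_whomog mE.
rewrite mulrCA -mE /mweight -prodrXr -big_split; congr (_ * _).
by apply: eq_bigr => j _; rewrite /= exprMn -exprM.
Qed.

Local Notation Q := {fraction {mpoly F[N]}}.

(** At the generic point x of the slice, the span of the b_j and [x, K] lie in P over the field Q;
    the rank of the latter is at least its value at y, so the two meet in some r != 0. The
    derivation in the direction r kills the trace functions, and [nontrivial_zero] applies. *)
Lemma slice_nontrivial_zero (K P : {vspace V}) (y : 'I_N -> F) :
    ~ countable [set: F] -> (forall u, \sum_j u j *: b j = 0 -> forall j, u j = 0) ->
    e \in P -> (forall j, b j \in P) ->
    (forall x z, x \in P -> z \in K -> br x z \in P) ->
    (\dim P < N + \dim (ad br (slice y) @: K))%N ->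
  exists a, (forall i : 'I_n, (slice_inv i).@[a] = 0) /\ exists j, a j != 0.
Proof.
move=> Func frb eP bP KP dimP.
pose iota : {rmorphism B -> Q} := @tofrac B.
pose kq : {rmorphism F -> Q} := @tofrac B \o @mpolyC N F.
have iotaC m1 m2 (X : 'M[F]_(m1, m2)) : map_mx iota (C X) = map_mx kq X.
  by apply/matrixP => i j; rewrite !mxE.
pose a := map_mx iota slice_mx.
have aE : a = map_mx kq (M e) + \sum_j iota 'X_j *: map_mx kq (M (b j)).
  rewrite /a /slice_mx map_mxD iotaC raddf_sum; congr (_ + _); apply: eq_bigr => j _.
  by rewrite /= map_mxZ iotaC.
pose Bm : 'M[F]_(N, n) := \matrix_j v2r (b j).
pose KX := C (vs2mx K) *m slice_mx.
pose A1 := map_mx kq Bm; pose A2 := map_mx iota KX.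
have KXE : A2 = map_mx kq (vs2mx K) *m a by rewrite /A2 /KX map_mxM iotaC.
have rkA2 : (\dim (ad br (slice y) @: K) <= \rank A2)%N.
  have [delta d0 dP] := @rank_generic F B (@mpolyC N F) (meval y) (@mevalC N F y) _ _ KX.
  have : iota delta != 0.
    by rewrite tofrac_eq0; apply: contraNneq d0 => ->; rewrite rmorph0.
  move/(dP Q iota); apply: leq_trans; rewrite dimv_img_mx map_mxM slice_mx_eval.
  rewrite (_ : map_mx _ (C _) = vs2mx K) //.
  by apply/matrixP => i j; rewrite !mxE /= mevalC.
have rkA1 : \rank A1 = N.
  rewrite mxrank_map; apply/eqP; rewrite -/(row_free _) -kermx_eq0.
  apply/rowV0P => u /sub_kermxP uB; apply/rowP => j; rewrite mxE; apply: frb.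
  apply: v2r_inj; rewrite linear0 -[RHS]uB linear_sum mulmx_sum_row.
  by apply: eq_bigr => l _; rewrite linearZ rowK.
have subP (x : V) : x \in P -> (vs2mx K *m M x <= vs2mx P)%MS.
  move=> xP; apply/row_subP => i; rewrite row_mul.
  have := KP x (r2v (row i (vs2mx K))) xP; rewrite !memv_v2r r2vK -adE v2r_lfun r2vK.
  by apply; apply: row_sub.
have sA1 : (A1 <= map_mx kq (vs2mx P))%MS.
  by rewrite map_submx; apply/row_subP => j; rewrite rowK -memv_v2r.
have sA2 : (A2 <= map_mx kq (vs2mx P))%MS.
  rewrite KXE aE mulmxDr mulmx_sumr addmx_sub //.
    by rewrite -map_mxM map_submx subP.
  apply: summx_sub => j _; rewrite -scalemxAr scalemx_sub //.
  by rewrite -map_mxM map_submx subP.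
have cap0 : (A1 :&: A2)%MS != 0.
  rewrite -mxrank_eq0 -lt0n.
  have := mxrank_sum_cap A1 A2; rewrite rkA1.
  have : (\rank (A1 + A2)%MS <= \dim P)%N.
    by rewrite /dimv -(mxrank_map kq) mxrankS // addsmx_sub sA1.
  move: dimP rkA2; lia.
pose r := nz_row (A1 :&: A2)%MS.
have r0 : r != 0 by rewrite nz_row_eq0.
have := nz_row_sub (A1 :&: A2)%MS; rewrite -/r sub_capmx => /andP[/submxP[v rv] /submxP[ka rk]].
(* Extension of scalars of ad to Q, as matrices depending linearly on a row; [La] is the
   corresponding form of [M_br]. *)
pose L (u : 'rV[Q]_n) := \sum_l u 0 l *: map_mx kq (M (r2v (delta_mx 0 l))).
have L_lin : linear L.
  move=> x u u'; rewrite /L scaler_sumr -big_split; apply: eq_bigr => l _ /=.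
  by rewrite !mxE scalerDl scalerA.
pose Ll := GRing.isLinear.Build Q _ _ *:%R L L_lin.
pose LL : {linear 'rV[Q]_n -> 'M[Q]_n} := HB.pack_for {linear 'rV[Q]_n -> 'M[Q]_n} L Ll.
have LE u : LL u = L u by [].
have LZ x u : LL (x *: u) = x *: LL u by exact: linearZ.
have LM x : LL (map_mx kq (v2r x)) = map_mx kq (M x).
  have xE : x = \sum_l v2r x 0 l *: r2v (delta_mx 0 l).
    by rewrite -{1}(v2rK x) {1}[v2r x]row_sum_delta linear_sum; apply: eq_bigr => l _; rewrite linearZ.
  rewrite LE /L {2}xE [ad br (\sum_l _)]linear_sum [f2mx (\sum_l _)]linear_sum.
  rewrite [RHS]raddf_sum; apply: eq_bigr => l _ /=.
  rewrite [ad br (_ *: _)]linearZ [f2mx (_ *: _)]linearZ mxE.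
  by apply/matrixP => i j; rewrite !mxE rmorphM.
have dE l : delta_mx 0 l = map_mx kq (v2r (r2v (delta_mx 0 l : 'rV[F]_n))) :> 'rV[Q]_n.
  by rewrite r2vK; apply/rowP => i; rewrite !mxE rmorph_nat.
have La u : LL (u *m a) = LL u *m a - a *m LL u.
  have Lx x l : LL (delta_mx 0 l *m map_mx kq (M x)) =
      LL (delta_mx 0 l) *m map_mx kq (M x) - map_mx kq (M x) *m LL (delta_mx 0 l).
    rewrite dE -map_mxM -v2r_lfun adE !LM M_br.
    by rewrite map_mxB !map_mxM.
  have uE : LL u = \sum_l u 0 l *: LL (delta_mx 0 l).
    by rewrite {1}[u]row_sum_delta [LL _]linear_sum; apply: eq_bigr => l _; rewrite linearZ.
  have uaE : LL (u *m a) = \sum_l u 0 l *: LL (delta_mx 0 l *m a).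
    rewrite {1}[u]row_sum_delta mulmx_suml [LL _]linear_sum; apply: eq_bigr => l _.
    by rewrite -scalemxAl linearZ.
  rewrite uE uaE mulmx_suml mulmx_sumr -sumrB; apply: eq_bigr => l _.
  rewrite -scalemxAl -scalemxAr -scalerBr; congr (_ *: _).
  rewrite aE mulmxDr mulmx_sumr linearD linear_sum mulmxDr mulmxDl opprD addrACA Lx.
  congr (_ + _); rewrite mulmx_sumr mulmx_suml -sumrB; apply: eq_bigr => j _.
  by rewrite -scalemxAr LZ Lx -scalemxAr -scalemxAl scalerBr.
pose D (p : B) : Q := \sum_j v 0 j * iota (p^`M(j)).
have DD p q : D (p + q) = D p + D q.
  rewrite -big_split; apply: eq_bigr => j _.
  by rewrite mderivD rmorphD mulrDr.
have DM p q : D (p * q) = iota p * D q + iota q * D p.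
  rewrite !mulr_sumr -big_split; apply: eq_bigr => j _ /=.
  by rewrite mderivM rmorphD !rmorphM /=; ring.
have DC x : D x%:MP = 0.
  by apply: big1 => j _; rewrite mderivC rmorph0 mulr0.
have DX j : D 'X_j = v 0 j.
  rewrite /D (bigD1 j) //= big1 ?addr0 => [|l lj]; last first.
    by rewrite mderivX mnm1E eq_sym (negPf lj) scale0r rmorph0 mulr0.
  rewrite mderivX mnm1E eqxx scale1r (_ : (_ - _)%MM = 0%MM) ?mpolyX0 ?rmorph1 ?mulr1 //.
  by apply/mnmP => i; rewrite mnmBE subnn mnm0E.
(* D moves x by r = [x, z], with z the row [ka *m map_mx kq (vs2mx K)], so its adjoint matrix moves
   by a commutator; the scalar in [derivation_trace_expr] is 0. *)
have DA : map_mx D slice_mx = 0 *: a + (a *m - LL (ka *m map_mx kq (vs2mx K)) -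
    - LL (ka *m map_mx kq (vs2mx K)) *m a).
  rewrite scale0r add0r mulmxN mulNmx opprK addrC -La -mulmxA -KXE -rk rv.
  rewrite mulmx_sum_row linear_sum; apply/matrixP => i j; rewrite !mxE !summxE.
  rewrite DD DC add0r (big_morph D DD (_ : D 0 = 0)); last by rewrite -(mpolyC0 N) DC.
  apply: eq_bigr => l _; rewrite LZ -map_row rowK LM !mxE DM DC mulr0 add0r DX.
  by rewrite mulrC.
apply: (nontrivial_zero Func (w := slice_weight) (c := fun i : 'I_n => slice_inv i)
  (d := fun i : 'I_n => (2 * i.+1)%N) (v := v 0)) => //.
- exact: pchar_num.
- by move=> i; apply: slice_inv_whomog.
- move=> i; have := derivation_trace_expr DD DM i DA.
  by rewrite mulr0 mul0r.
- by apply/rV0Pn; apply: contraNneq r0 => v0; rewrite rv v0 mul0mx.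
Qed.

End Slice.

(** * Pencils of endomorphisms *)

Section LinearAlgebra.
Variables (F : numClosedFieldType) (V : vectType F).
Implicit Types (f g : 'End(V)) (U W : {vspace V}) (v : V).

Lemma mem_leigenspace f a v : (v \in passmx.leigenspace f a) = (f v == a *: v).
Proof.
by rewrite memv_ker add_lfunE opp_lfunE scale_lfunE id_lfunE subr_eq0.
Qed.

Lemma dimv_limg_add f W :
  \dim (limg f + W) = \rank (col_mx (f2mx f) (vs2mx W)).
Proof.
have E1 : (vs2mx (limg f) :=: f2mx f)%MS.
  rewrite unlock /=; apply: eqmx_trans (genmxE _) _.
  by apply: eqmx_trans (eqmxMr _ (genmxE _)) _; rewrite mul1mx; apply: eqmx_refl.
rewrite -(addsmxE (f2mx f) (vs2mx W)) /dimv [vs2mx (_ + _)]/= genmxE.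
by rewrite (adds_eqmx E1 (eqmx_refl (vs2mx W))).
Qed.

Lemma f2mx_pencil f g t : f2mx (f + t *: g)%R = f2mx f + t *: f2mx g.
Proof. by rewrite addrC linearP addrC. Qed.

Lemma nilpotent_ker f m W : (forall v, iter m f v = 0) -> (f @: W <= W)%VS ->
  W != 0%VS -> (W :&: lker f != 0)%VS.
Proof.
move=> fm fW; rewrite -vpick0 => w0; set w := vpick W in w0.
have : exists j, iter j f w == 0 by exists m; rewrite fm.
case/ex_minnP => -[|j] /eqP jw jmin; first by rewrite -jw /= eqxx in w0.
have jW : iter j f w \in W.
  by elim: (j) => [|i iW] /=; [exact: memv_pick | apply: (subvP fW); apply: memv_img].
apply: contraTneq isT => cap0; have : iter j f w \in (W :&: lker f)%VS.
  by rewrite memv_cap jW memv_ker -iterS jw eqxx.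
by rewrite cap0 memv0 => /jmin; rewrite ltnn.
Qed.

Lemma fitting f : exists m, exists W0 W1 : {vspace V},
  [/\ (W0 :&: W1 = 0)%VS, (W0 + W1 = fullv)%VS,
      forall v, v \in W0 <-> exists j, iter j f v = 0 &
      forall v, v \in W1 <-> exists u, v = iter m f u].
Proof.
pose S m : 'End(V) := linfun (iter m f).
have SE m v : S m v = iter m f v by rewrite lfunE.
pose Q k := `[< exists m, \dim (lker (S m)) = k >].
have Q0 : exists k, Q k.
  by exists (\dim (lker (S 0%N))); apply/asboolP; exists 0%N.
have Qle k : Q k -> (k <= \dim {:V})%N.
  by case/asboolP=> m <-; apply/dimvS/subvf.
case: (ex_maxnP Q0 Qle) => k /asboolP[m mk] kmax.
have kerS j : (lker (S (j + m)%N) <= lker (S m))%VS.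
  have le : (lker (S m) <= lker (S (j + m)%N))%VS.
    apply/subvP => v; rewrite !memv_ker !SE iterD => /eqP->.
    by rewrite linear0.
  have /kmax : Q (\dim (lker (S (j + m)%N))).
    by apply/asboolP; exists (j + m)%N.
  by rewrite -mk => le'; have /eqP -> : lker (S m) == lker (S (j + m)%N) by rewrite eqEdim le.
exists m, (lker (S m)), (limg (S m)); have cap0 : (lker (S m) :&: limg (S m) = 0)%VS.
  apply/eqP; rewrite -subv0; apply/subvP => v /memv_capP[kv /memv_imgP[u _ vE]].
  have : u \in lker (S (m + m)%N) by move: kv; rewrite vE !memv_ker !SE iterD.
  by move/(subvP (kerS m)); rewrite memv_ker vE memv0.
split=> // [|v|v].
- apply/eqP; rewrite eqEdim subvf /=.
  have := dimv_sum_cap (lker (S m)) (limg (S m)); rewrite cap0 dimv0 addn0 => ->.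
  by have := limg_ker_dim (S m) fullv; rewrite capfv => ->.
- rewrite memv_ker SE; split=> [/eqP|[j jv]]; first by exists m.
  have : v \in lker (S (m + j)%N) by rewrite memv_ker SE iterD jv linear0.
  by rewrite addnC => /(subvP (kerS j)); rewrite memv_ker SE.
split=> [/memv_imgP[u _ ->]|[u ->]]; first by exists u; rewrite SE.
by rewrite -SE memv_img ?memvf.
Qed.

(** For all but finitely many t, the rank on W0 is at least that at t = 0 and the rank on W1 at
    least that at t = 1, which is full there whereas f has a kernel. *)
Lemma pencil_rank f g W0 W1 :
    (W0 :&: W1 = 0)%VS -> (W0 + W1 = fullv)%VS ->
    (f @: W0 <= W0)%VS -> (f @: W1 <= W1)%VS ->
    (g @: W0 <= W0)%VS -> (g @: W1 <= W1)%VS ->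
    (W1 :&: lker (f + g)%R = 0)%VS -> (W1 :&: lker f != 0)%VS ->
  exists t, (\dim (limg f) < \dim (limg (f + t *: g)%R))%N.
Proof.
move=> W01 W0W1 f0 f1 g0 g1 inj ninj.
pose A U : 'M[{poly F}]_(dim V) :=
  map_mx (@polyC F) (vs2mx U) *m (map_mx (@polyC F) (f2mx f) + 'X *: map_mx (@polyC F) (f2mx g)).
have polyCK t : cancel (@polyC F) (horner_eval t) by move=> a; rewrite /horner_eval hornerC.
have AE U t : \rank (map_mx (horner_eval t) (A U)) = \dim ((f + t *: g)%R @: U).
  rewrite dimv_img_mx /A map_mxM map_mxD map_mxZ.
  rewrite f2mx_pencil.
  have mC (X : 'M[F]_(dim V)) : map_mx (horner_eval t) (map_mx (@polyC F) X) = X.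
    by apply/matrixP => i j; rewrite !mxE polyCK.
  by rewrite !mC /= /horner_eval hornerX.
have [d0 d00 d0P] := rank_generic (polyCK 0) (A W0).
have [d1 d11 d1P] := rank_generic (polyCK 1) (A W1).
have : d0 * d1 != 0.
  rewrite mulf_neq0 //; first by apply: contraNneq d00 => ->; rewrite rmorph0.
  by apply: contraNneq d11 => ->; rewrite rmorph0.
case/closed_nonrootP => t; rewrite /root hornerM mulf_eq0 negb_or => /andP[t0 t1].
exists t; have := d0P F (horner_eval t) t0; have := d1P F (horner_eval t) t1.
rewrite !AE scale1r scale0r addr0 limg_dim_eq // => r1 r0.
have imgD (x : 'End(V)) : limg x = (x @: W0 + x @: W1)%VS by rewrite -limgD W0W1.
have stab x U : (f @: U <= U)%VS -> (g @: U <= U)%VS -> ((f + x *: g)%R @: U <= U)%VS.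
  move=> fU gU; apply/subvP => _ /memv_imgP[u uU ->].
  rewrite add_lfunE scale_lfunE memvD ?memvZ //.
    by apply: (subvP fU); apply: memv_img.
  by apply: (subvP gU); apply: memv_img.
have cap0 : ((f + t *: g)%R @: W0 :&: (f + t *: g)%R @: W1 = 0)%VS.
  by apply/eqP; rewrite -subv0 -W01 capvS ?stab.
rewrite !imgD (dimv_disjoint_sum cap0).
have := dimv_sum_cap (f @: W0) (f @: W1); have := limg_ker_dim f W1.
have : (0 < \dim (W1 :&: lker f))%N by rewrite lt0n dimv_eq0.
move=> n0 n1 n2; apply: leq_ltn_trans (_ : (_ <= \dim (f @: W0) + \dim (f @: W1))%N) _.
  by rewrite -n2 leq_addr.
by rewrite (leq_trans _ (leq_add r0 r1)) // ltn_add2l -n1 -[X in (X < _)%N]add0n ltn_add2r.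
Qed.

Lemma basis_of_sums (P : V -> Prop) U :
    (forall v, v \in U -> exists2 r : seq V, v = \sum_(x <- r) x &
       forall x, x \in r -> x \in U /\ P x) ->
  exists2 X : seq V, basis_of U X & forall x, x \in X -> P x.
Proof.
move=> UP; pose Q k := `[< exists X : seq V, [/\ free X, size X = k &
  forall x, x \in X -> x \in U /\ P x] >].
have Q0 : exists k, Q k by exists 0%N; apply/asboolP; exists [::]; rewrite nil_free.
have Qle k : Q k -> (k <= \dim U)%N.
  case/asboolP=> X [/eqP frX <- XU]; rewrite -frX; apply: dimvS.
  by apply/span_subvP => x /XU[].
case: (ex_maxnP Q0 Qle) => k /asboolP[X [frX sX XU]] kmax; exists X; last by move=> x /XU[].
rewrite /basis_of frX andbT eqEsubv; apply/andP; split.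
  by apply/span_subvP => x /XU[].
apply/subvP => v /UP[r -> rP]; rewrite big_seq; apply: memv_suml => x /rP[Ux Px].
apply: contraT => nx; have /kmax : Q k.+1; last by rewrite ltnn.
apply/asboolP; exists (x :: X); rewrite free_cons nx frX /= sX; split=> // y.
by rewrite inE => /predU1P[->|/XU].
Qed.

End LinearAlgebra.

Section KillingOrthogonal.
Variables (F : numClosedFieldType) (V : vectType F) (br : lie_bracket V).

Lemma killing_orthogonal_dim (U W : {vspace V}) : semisimple br ->
  (forall x y, x \in U -> y \in W -> killing br x y = 0) ->
  (\dim U + \dim W <= dim V)%N.
Proof.
move=> ss UW; pose T : 'M[F]_(dim V, \dim W) :=
  \matrix_(l, i) killing br (r2v (delta_mx 0 l)) (vbasis W)`_i.
have kD y : killing br 0 y = 0 by rewrite /killing linear0 comp_lfun0l linear0.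
have klin (I : finType) (c : I -> F) (E : I -> V) y :
    killing br (\sum_i c i *: E i) y = \sum_i c i * killing br (E i) y.
  have kadd : {morph (killing br)^~ y : u v / u + v}.
    by move=> u v; rewrite -[u]scale1r killing_linearl mul1r scale1r.
  rewrite (big_morph _ kadd (kD y)); apply: eq_bigr => i _.
  by rewrite -[c i *: _]addr0 killing_linearl kD addr0.
have xE (x : V) : x = \sum_l v2r x 0 l *: r2v (delta_mx 0 l).
  by rewrite -{1}(v2rK x) {1}[v2r x]row_sum_delta linear_sum; apply: eq_bigr => l _; rewrite linearZ.
have rT : \rank T = \dim W.
  rewrite -mxrank_tr; apply/eqP; rewrite -/(row_free _) -kermx_eq0.
  apply/rowV0P => c /sub_kermxP cT.
  have /(killing_nondegenerate ss) : forall y, killing br (\sum_i c 0 i *: (vbasis W)`_i) y = 0.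
    move=> y; rewrite killingC [y]xE klin big1 // => l _.
    rewrite killingC klin; have := congr1 (fun X : 'rV_(dim V) => X 0 l) cT.
    rewrite !mxE => cl; rewrite (eq_bigr (fun i => c 0 i * T^T i l)) ?cl ?mulr0 //.
    by move=> i _; rewrite !mxE killingC.
  have /freeP fr := basis_free (vbasisP W).
  by move/fr => c0; apply/rowP => i; rewrite c0 mxE.
have : vs2mx U *m T = 0.
  apply/row_matrixP => i; rewrite row_mul row0; apply/rowP => j; rewrite !mxE.
  pose x := r2v (row i (vs2mx U)).
  have xU : x \in U by rewrite memv_v2r r2vK row_sub.
  rewrite -[RHS](UW x (vbasis W)`_j) //; last by apply: vbasis_mem; rewrite mem_nth ?size_tuple.
  rewrite [in RHS](xE x) klin; apply: eq_bigr => l _.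
  by rewrite /x r2vK !mxE.
by move/mulmx0_rank_max; rewrite rT.
Qed.

End KillingOrthogonal.

Lemma sl2_triple_rep (F : numClosedFieldType) (V : vectType F) (br : lie_bracket V) e h f :
  sl2_triple br e h f -> sl2_rep (ad br e) (ad br h) (ad br f).
Proof.
case=> he hf ef; split=> v; rewrite !adE br_der ?he ?hf ?ef.
- by rewrite brZl addrC.
- by rewrite brNl brZl addrC.
- by rewrite addrC.
Qed.

(** * Involutions *)

Section Involution.
Variables (F : numClosedFieldType) (V : vectType F) (br : lie_bracket V).
Variable theta : 'End(V).
Hypothesis thetaP : lie_involution br theta.
Local Notation k := (even_space theta).
Local Notation p := (odd_space theta).
Implicit Types x y z : V.

Lemma even_spaceP x : x \in k <-> theta x = x.
Proof. by rewrite mem_leigenspace scale1r; split=> [/eqP|->]. Qed.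

Lemma odd_spaceP x : x \in p <-> theta x = - x.
Proof. by rewrite mem_leigenspace scaleN1r; split=> [/eqP|->]. Qed.

Lemma theta_br x y : theta (br x y) = br (theta x) (theta y).
Proof. by case: thetaP => [[_ ->]]. Qed.

Lemma thetaK x : theta (theta x) = x.
Proof. by case: thetaP => _ tt _; rewrite -comp_lfunE tt id_lfunE. Qed.

Lemma br_odd_odd x y : x \in p -> y \in p -> br x y \in k.
Proof.
move=> /odd_spaceP xE /odd_spaceP yE; apply/even_spaceP.
by rewrite theta_br xE yE brNl brNr opprK.
Qed.

Lemma br_odd_even x y : x \in p -> y \in k -> br x y \in p.
Proof.
move=> /odd_spaceP xE /even_spaceP yE; apply/odd_spaceP.
by rewrite theta_br xE yE brNl.
Qed.

Lemma even_odd_direct : (k :&: p = 0)%VS.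
Proof.
apply/eqP; rewrite -subv0; apply/subvP => x /memv_capP[/even_spaceP xk /odd_spaceP xp].
have /eqP : 2 *: x = 0 by rewrite scaler_nat mulr2n -{1}xk xp addNr.
by rewrite scaler_eq0 pnatr_eq0 /= => /eqP->; rewrite mem0v.
Qed.

Lemma even_odd_parts x :
  [/\ 2^-1 *: (x + theta x) \in k, 2^-1 *: (x - theta x) \in p &
      x = 2^-1 *: (x + theta x) + 2^-1 *: (x - theta x)].
Proof.
split.
- by apply/even_spaceP; rewrite lfZ lfD thetaK addrC.
- by apply/odd_spaceP; rewrite lfZ lfD lfN thetaK -scalerN opprB addrC.
rewrite -scalerDr addrACA subrr addr0 -mulr2n -scaler_nat scalerA mulVf ?scale1r //.
by rewrite pnatr_eq0.
Qed.

Lemma even_odd_full : (k + p = fullv)%VS.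
Proof.
apply/eqP; rewrite eqEsubv subvf; apply/subvP => x _.
by have [xk xp ->] := even_odd_parts x; rewrite memv_add.
Qed.

Lemma killing_theta x y : killing br (theta x) (theta y) = killing br x y.
Proof.
have adt z : ad br (theta z) = (theta \o ad br z \o theta)%VF.
  by apply/lfunP => v; rewrite !comp_lfunE !adE theta_br thetaK.
transitivity (lftrace (theta \o ((ad br x \o ad br y) \o theta))%VF).
  by congr lftrace; rewrite !adt; apply/lfunP => v; rewrite !comp_lfunE !thetaK.
by rewrite lftraceC; congr lftrace; apply/lfunP => v; rewrite !comp_lfunE !thetaK.
Qed.

Lemma killing_even_odd x y : x \in k -> y \in p -> killing br x y = 0.
Proof.
move=> /even_spaceP xk /odd_spaceP yp; have := killing_theta x y; rewrite xk yp.
have -> : - y = -1 *: y + 0 by rewrite scaleN1r addr0.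
rewrite killingC killing_linearl {2}/killing linear0 comp_lfun0l linear0 addr0 mulN1r killingC.
move/eqP; rewrite eq_sym -addr_eq0 -mulr2n -mulr_natl mulf_eq0 pnatr_eq0.
by move/eqP.
Qed.

Hypothesis ss : semisimple br.

(** The image [x, A] lies in B, so it is Killing-orthogonal to A; by invariance it is also
    orthogonal to the centralizer of x in B. Nondegeneracy bounds its dimension by dim B minus that
    of this centralizer. *)
Lemma dim_ad_swap x (A B : {vspace V}) :
    (A :&: B = 0)%VS -> (A + B = fullv)%VS ->
    (forall y z, y \in A -> z \in B -> killing br y z = 0) ->
    (forall y, y \in A -> br x y \in B) ->
  (\dim (ad br x @: A) <= \dim (ad br x @: B))%N.
Proof.
move=> cap0 full AB xA.
have := @killing_orthogonal_dim _ _ br (ad br x @: A) (A + (B :&: lker (ad br x)))%VS ss.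
have cap1 : (A :&: (B :&: lker (ad br x)) = 0)%VS by rewrite capvA cap0 cap0v.
rewrite (dimv_disjoint_sum cap1) -dimvf -full (dimv_disjoint_sum cap0).
have <- := limg_ker_dim (ad br x) B.
have arith (a b c d : nat) : (a + (b + c) <= b + (c + d))%N -> (a <= d)%N by lia.
move=> H; apply: (arith _ (\dim A) (\dim (B :&: lker (ad br x)))).
apply: H => _ _ /memv_imgP[y yA ->] /memv_addP[a aA [b /memv_capP[bB bx] ->]].
rewrite adE killingC -[a]scale1r killing_linearl mul1r [killing br a _]AB ?xA // add0r.
rewrite killingC brC -scaleN1r -[_ *: _]addr0 killing_linearl killing_inv.
move: bx; rewrite memv_ker adE => /eqP->.
by rewrite /killing !linear0 comp_lfun0l comp_lfun0r linear0 mulr0 addr0.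
Qed.

Lemma dim_ad_odd x : x \in p -> \dim (ad br x @: p) = \dim (ad br x @: k).
Proof.
move=> xp; apply/eqP; rewrite eqn_leq !dim_ad_swap //.
- exact: even_odd_direct.
- exact: even_odd_full.
- exact: killing_even_odd.
- by move=> y; apply: br_odd_even.
- by rewrite capvC even_odd_direct.
- by rewrite addvC even_odd_full.
- by move=> y z yp zk; rewrite killingC killing_even_odd.
- by move=> y; apply: br_odd_odd.
Qed.

Lemma dim_limg_ad_odd x : x \in p ->
  \dim (limg (ad br x)) = (2 * \dim (ad br x @: k))%N.
Proof.
move=> xp; rewrite -even_odd_full limgD dimv_disjoint_sum ?dim_ad_odd ?mul2n ?addnn //.
apply/eqP; rewrite -subv0; apply/subvP => z /memv_capP[/memv_imgP[y yk ->] /memv_imgP[w wp]].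
rewrite !adE => yw; rewrite -even_odd_direct memv_cap br_odd_even // andbT.
by rewrite yw br_odd_odd.
Qed.

End Involution.

(** * Principal nilpotent elements *)

(** Some equation q of the closed complement does not vanish at e, and the nilpotent elements of p
    where q is nonzero lie in the orbit of e. Elements of K are automorphisms, the adjoint group
    being a component of [lie_aut]. *)
Lemma principal_open (F : fieldType) (V : vectType F) (br : lie_bracket V)
    (theta : 'End(V)) (m : {vspace V}) (K : set 'End(V)) e :
    connected_subgroup_with_lie_algebra br m K ->
    principal_nilpotents br theta K e ->
  exists q, poly_eval q e != 0 /\ forall y, nilcone br theta y ->
    poly_eval q y != 0 -> exists2 phi, lie_aut br phi & y = phi e.
Proof.
case=> Kadj [KGL _ _ KM KV] _ _ [O [[x _ OE]]]; case=> _ [S ->] OS Oe.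
have := Oe; rewrite OS => -[_ /= /existsNP[q /not_implyP[Sq /eqP qe]]].
exists q; split=> // y yn qy.
have : O y by rewrite OS; split=> // /(_ q Sq) /eqP; rewrite (negPf qy).
move: Oe; rewrite OE => -[a Ka ax] [c Kc cx]; exists (c \o a^-1)%VF.
  have /Kadj[C [CA _ _ Cc]] := KM _ _ Kc (KV _ Ka).
  exact: CA.
by rewrite comp_lfunE -ax lker0_lfunK ?cx //; apply: KGL.
Qed.

Lemma dim_limg_ad_aut (F : fieldType) (V : vectType F) (br : lie_bracket V) phi x :
  lie_aut br phi -> (\dim (limg (ad br (phi x))) <= \dim (limg (ad br x)))%N.
Proof.
case=> phi_inj phiM; have <- := limg_ker_dim phi (limg (ad br x)).
apply: leq_trans (leq_addl _ _); apply: dimvS; apply/subvP => _ /memv_imgP[v _ ->].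
have [w ->] : exists w, v = phi w by exists ((phi^-1)%VF v); rewrite lker0_lfunVK.
by rewrite adE -phiM -adE; do 2!apply: memv_img; rewrite memvf.
Qed.

(** * Nilpotent elements and ranks on the slice *)

Section RigidSlice.
Variables (F : numClosedFieldType) (V : vectType F) (br : lie_bracket V).
Variables (theta : 'End(V)) (e h f : V) (q : {mpoly F[\dim {:V}]}).
Hypotheses (ss : semisimple br) (thetaP : lie_involution br theta).
Hypothesis ehf : sl2_triple br e h f.
Local Notation k := (even_space theta).
Local Notation p := (odd_space theta).
Hypotheses (ep : e \in p) (fp : f \in p).
Hypothesis qe : poly_eval q e != 0.
Hypothesis qP : forall y, nilcone br theta y -> poly_eval q y != 0 ->
  exists2 phi, lie_aut br phi & y = phi e.
Variables (N : nat) (b : 'I_N -> V) (dd : 'I_N -> nat).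
Hypothesis hb : forall j, br h (b j) = - (dd j)%:R *: b j.
Hypothesis fb : forall j, br f (b j) = 0.
Hypothesis bp : forall j, b j \in p.
Hypothesis frb : forall u, \sum_j u j *: b j = 0 -> forall j, u j = 0.

Let he : br h e = 2 *: e. Proof. by case: ehf. Qed.

Lemma slice_odd a : slice e b a \in p.
Proof. by rewrite memvD // memv_suml // => j _; rewrite memvZ. Qed.

Lemma slice_nilpotent a :
  (forall i : 'I_(dim V), (slice_inv br e b i).@[a] = 0) -> ad_nilpotent br (slice e b a).
Proof.
move=> a0; have [m /f2mx_expr0 xm] : exists m, f2mx (ad br (slice e b a)) ^+ m = 0.
  apply: mx_nilpotent_trace => i iV.
  by have := a0 (Ordinal iV); rewrite slice_inv_eval.
by exists m => y; rewrite -iter_ad xm.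
Qed.

(* The contracting torus t^h t moves a nilpotent element of the slice towards
   e, hence into the open orbit. *)
Lemma slice_rigid a :
  (forall i : 'I_(dim V), (slice_inv br e b i).@[a] = 0) -> forall j, a j = 0.
Proof.
move=> a0; pose w := slice_weight dd; pose at_ t j := t ^+ w j * a j.
pose X t := slice e b (at_ t).
have polyCK t : cancel (@polyC F) (horner_eval t) by move=> c; rewrite /horner_eval hornerC.
pose A : 'M[{poly F}]_(dim V) := map_mx (@polyC F) (f2mx (ad br e)) +
  \sum_j 'X^(w j) *: map_mx (@polyC F) (f2mx (ad br (a j *: b j))).
have mC t m1 m2 (Y : 'M[F]_(m1, m2)) : map_mx (horner_eval t) (map_mx (@polyC F) Y) = Y.
  by apply/matrixP => i j; rewrite !mxE polyCK.
have AE t : map_mx (horner_eval t) A = f2mx (ad br (X t)).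
  apply/matrixP => i j; rewrite /X /slice linearD linear_sum linearD linear_sum /=.
  rewrite !mxE /horner_eval hornerD hornerC !summxE horner_sum; congr (_ + _).
  apply: eq_bigr => l _.
  by rewrite /at_ -scalerA !linearZ /= !mxE hornerM hornerXn hornerC.
pose W := lker (ad br f); pose B := col_mx A (map_mx (@polyC F) (vs2mx W)).
have BE t : \rank (map_mx (horner_eval t) B) = \dim (limg (ad br (X t)) + W).
  by rewrite map_col_mx AE mC dimv_limg_add.
have X0 : X 0 = e.
  rewrite /X /slice big1 ?addr0 // => j _.
  by rewrite /at_ /w /slice_weight addn2 expr0n mul0r scale0r.
have [dir0 dirf] := limg_lker_direct (sl2_triple_rep ehf).
have [d d0 dP] := rank_generic (polyCK 0) B.
pose Z i : {poly F} := (coord (vbasis {:V}) i e)%:P +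
  \sum_j (a j * coord (vbasis {:V}) i (b j)) *: 'X^(w j).
pose Q := \sum_(m <- msupp q) q@_m *: \prod_i Z i ^+ m i.
have QE t : Q.[t] = poly_eval q (X t).
  rewrite /poly_eval mevalE horner_sum; apply: eq_bigr => m _.
  rewrite hornerZ horner_prod; congr (_ * _); apply: eq_bigr => i _.
  rewrite horner_exp hornerD hornerC horner_sum /X /slice linearD linear_sum.
  congr ((_ + _) ^+ _); apply: eq_bigr => j _ /=.
  by rewrite hornerZ hornerXn linearZ /= /at_ [in RHS](mulrC (t ^+ _)) mulrAC.
(* Outside the roots of this product, [X t, g] + g^f is all of g, q is nonzero at X t, and t is
   invertible. *)
have : d * Q * 'X != 0.
  rewrite !mulf_neq0 ?polyX_eq0 //.
    by apply: contraNneq d0 => ->; rewrite rmorph0.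
  by apply: contraNneq qe => Q0; rewrite -X0 -QE Q0 horner0.
case/closed_nonrootP => t; rewrite /root !hornerM !mulf_eq0 hornerX !negb_or.
case/andP=> /andP[dt]; rewrite QE => qt t0.
have Xn : ad_nilpotent br (X t).
  by apply: slice_nilpotent => i; apply: (slice_inv_scale he hb).
have [phi phiA XE] : exists2 phi, lie_aut br phi & X t = phi e.
  by apply: qP => //; split=> //; apply: slice_odd.
have := dP F (horner_eval t) dt; rewrite !BE X0 dirf => full.
have le : (\dim (limg (ad br (X t))) <= \dim (limg (ad br e)))%N by rewrite XE dim_limg_ad_aut.
(* The sum is full, and conjugacy with e prevents [X t, g] from being larger than [e, g], so the sum
   is direct as it is at e. *)
have cap0 : (limg (ad br (X t)) :&: W = 0)%VS.
  apply/eqP; rewrite -dimv_eq0 -leqn0.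
  have := dimv_sum_cap (limg (ad br (X t))) W.
  have := dimv_sum_cap (limg (ad br e)) W; rewrite dir0 dirf dimv0 addn0.
  move: full le; move: (\dim (_ + _)) (\dim (_ :&: _)) (\dim fullv) (\dim W) => *; lia.
have inX y : br (X t) y \in limg (ad br (X t)) by rewrite -adE memv_img ?memvf.
(* For x = X t = phi e, the Euler vector 2 x - [h, x] lies in [x, g], since 2 x = phi [h, e] =
   [phi h, x]. It is a combination of the b_j, hence lies in g^f, and therefore vanishes. *)
have s0 : \sum_j ((w j)%:R * at_ t j) *: b j = 0.
  apply/eqP; rewrite -memv0 -cap0 memv_cap; apply/andP; split; last first.
    by apply: memv_suml => j _; rewrite memvZ // memv_ker adE fb.
  have -> : \sum_j ((w j)%:R * at_ t j) *: b j = 2 *: X t - br h (X t).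
    rewrite /X /slice brDr he scalerDr opprD addrACA subrr add0r.
    rewrite scaler_sumr [br h _]linear_sum -sumrB; apply: eq_bigr => j _ /=.
    rewrite brZr hb /w /slice_weight natrD; lmod_ring.
  rewrite (brC br h) opprK memvD ?inX // XE -linearZ /= -he.
  by case: phiA => _ ->; rewrite -XE brC memvN inX.
move=> j; have /eqP := frb s0 j; rewrite !mulf_eq0 expf_eq0 (negPf t0) andbF pnatr_eq0.
by rewrite /w /slice_weight addn2 /= => /eqP.
Qed.

Hypothesis Nf : N = \dim (p :&: lker (ad br f)).
Hypothesis Func : ~ countable [set: F].

(** The odd part of g = [e, g] + g^f reads p = [e, k] + p^f. *)
Lemma dim_odd_slice : (\dim p <= N + \dim (ad br e @: k))%N.
Proof.
rewrite Nf addnC; apply: leq_trans (dimv_add_leqif _ _).1; apply: dimvS.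
apply/subvP => x xp; have [_ dirf] := limg_lker_direct (sl2_triple_rep ehf).
have : x \in (limg (ad br e) + lker (ad br f))%VS by rewrite dirf memvf.
case/memv_addP=> _ /memv_imgP[u _ ->] [z zf xE].
have -> : x = br e (2^-1 *: (u + theta u)) + 2^-1 *: (z - theta z).
  have /odd_spaceP thx := xp; have /odd_spaceP the := ep.
  have -> : x = 2^-1 *: (x - theta x).
    by rewrite thx opprK -mulr2n -scaler_nat scalerA mulVf ?scale1r // pnatr_eq0.
  rewrite {1 2}xE !adE lfD theta_br // the brZr brDr brNl -scalerDr; congr (_ *: _).
  by rewrite opprD opprK addrACA.
have [uk _ _] := even_odd_parts thetaP u; have [_ zp _] := even_odd_parts thetaP z.
rewrite memv_add // ?memv_cap ?zp.
  by rewrite -adE memv_img.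
move: zf; rewrite !memv_ker !adE brZr brBr => /eqP fz.
have /odd_spaceP thf := fp; have := theta_br thetaP f z.
by rewrite fz linear0 thf brNl => /esym/eqP; rewrite oppr_eq0 => /eqP->; rewrite subr0 scaler0 eqxx.
Qed.

Lemma slice_dim_limg y :
  (\dim (limg (ad br (slice e b y))) <= \dim (limg (ad br e)))%N.
Proof.
rewrite !(dim_limg_ad_odd thetaP ss) ?slice_odd // leq_mul2l /= leqNgt.
apply/negP => lt; have [||||a [a0 [j]]] :=
  slice_nontrivial_zero he hb (K := k) (P := p) (y := y) Func frb.
- exact: ep.
- exact: bp.
- by move=> x z; apply: br_odd_even.
- by apply: leq_ltn_trans dim_odd_slice _; rewrite ltn_add2l.
by rewrite (slice_rigid a0) eqxx.
Qed.

End RigidSlice.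

(** * Weights of a principal triple *)

Section PrincipalTriple.
Variables (F : numClosedFieldType) (V : vectType F) (br : lie_bracket V).
Variables (theta : 'End(V)) (e h f : V) (q : {mpoly F[\dim {:V}]}).
Hypotheses (ss : semisimple br) (thetaP : lie_involution br theta).
Hypothesis ehf : sl2_triple br e h f.
Local Notation k := (even_space theta).
Local Notation p := (odd_space theta).
Hypotheses (hk : h \in k) (ep : e \in p) (fp : f \in p).
Hypothesis qe : poly_eval q e != 0.
Hypothesis qP : forall y, nilcone br theta y -> poly_eval q y != 0 ->
  exists2 phi, lie_aut br phi & y = phi e.
Hypothesis Func : ~ countable [set: F].
Implicit Types (s v w x y : V) (d : int).

Let EHG := sl2_triple_rep ehf.
Local Notation E := (ad br e).
Local Notation H := (ad br h).
Local Notation G := (ad br f).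

Lemma weight_theta d v : H v = d%:~R *: v -> H (theta v) = d%:~R *: theta v.
Proof.
rewrite !adE => hv; have /even_spaceP hE := hk.
by rewrite -[in LHS]hE -theta_br // hv lfZ.
Qed.

Lemma weight_projection_theta S pi d v : weight_projections H S pi ->
  pi d (theta v) = theta (pi d v).
Proof.
move=> piP; have := @projection_shift _ _ H S pi theta 0 v piP _ d.
by rewrite addr0; apply=> c w; rewrite addr0; apply: weight_theta.
Qed.

Lemma odd_centralizer_basis : exists2 X : seq V, basis_of (p :&: lker G)%VS X &
  forall x, x \in X -> exists d : nat, br h x = - d%:R *: x.
Proof.
apply: basis_of_sums => v; rewrite memv_cap memv_ker => /andP[/odd_spaceP vp /eqP Gv].
have [S [pi piP]] := weight_projections_exist EHG; have [sumS piH _ _] := piP.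
exists [seq pi d v | d <- S]; first by rewrite big_map -sumS.
have Gpi d : G (pi d v) = 0.
  by rewrite -(projection_shift v piP (weight_Gz EHG)) Gv linear0.
move=> _ /mapP[d _ ->]; split.
  rewrite memv_cap memv_ker Gpi eqxx andbT; apply/odd_spaceP.
  by rewrite -(weight_projection_theta _ _ piP) vp lfN.
have [->|v0] := eqVneq (pi d v) 0; first by exists 0%N; rewrite linear0 scaler0.
have Hv : (- H)%R (pi d v) = (- d%:~R) *: pi d v by rewrite opp_lfunE piH scaleNr.
have [i di] := highest_weight_nat (sl2_rep_sym EHG) (Gpi d) Hv v0.
by exists i; rewrite -di opprK -piH adE.
Qed.

Lemma principal_slice s : s \in p -> br f s = 0 ->
  (\dim (limg (ad br (e + s))) <= \dim (limg E))%N /\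
  (ad_nilpotent br (e + s) -> s = 0).
Proof.
move=> sp fs; have [X Xb Xh] := odd_centralizer_basis.
have [N sX] : exists N, size X = N by exists (size X).
pose T : N.-tuple V := tcast sX (in_tuple X).
have TE : T = X :> seq V by rewrite val_tcast.
have Tb : basis_of (p :&: lker G)%VS T by rewrite TE.
pose b (j : 'I_N) := T`_j.
have bX j : b j \in X by rewrite /b TE mem_nth // sX.
have [dd hb] := choice (fun j => Xh _ (bX j)).
have bU j : b j \in (p :&: lker G)%VS by apply: (basis_mem Xb).
have bp j : b j \in p by have /memv_capP[] := bU j.
have fb j : br f (b j) = 0.
  by have /memv_capP[_] := bU j; rewrite memv_ker adE => /eqP.
have frb u : \sum_j u j *: b j = 0 -> forall j, u j = 0.
  by have /freeP fr := basis_free Tb; apply: fr.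
have NE : N = \dim (p :&: lker G) by rewrite (vector.size_basis Tb).
have sU : s \in (p :&: lker G)%VS by rewrite memv_cap sp memv_ker adE fs eqxx.
have sE : e + s = slice e b (fun j => coord T j s).
  by rewrite /slice {1}(coord_basis Tb sU).
split; rewrite sE; first exact: (slice_dim_limg ss thetaP ehf ep fp qe qP hb fb bp frb NE Func).
case=> m nil; rewrite (coord_basis Tb sU) big1 // => j _.
rewrite (slice_rigid (a := fun j => coord T j s) ehf ep fp qe qP hb fb bp frb) ?scale0r // => i.
have [he _ _] := ehf; rewrite slice_inv_eval; apply: (@mxtrace_nilpotent _ _ _ m).
rewrite -exprM mulnC exprM (_ : _ ^+ m = 0) ?expr0n //.
by apply/f2mx_expr0 => v; rewrite iter_ad nil.
Qed.

Lemma principal_no_pencil s (W0 W1 : {vspace V}) :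
    s \in p -> br f s = 0 ->
    (W0 :&: W1 = 0)%VS -> (W0 + W1 = fullv)%VS ->
    (E @: W0 <= W0)%VS -> (E @: W1 <= W1)%VS ->
    (ad br s @: W0 <= W0)%VS -> (ad br s @: W1 <= W1)%VS ->
    (W1 :&: lker (E + ad br s)%R = 0)%VS ->
  W1 = 0%VS.
Proof.
move=> sp fs cap0 full E0 E1 s0 s1 inj; apply/eqP; apply: contraT => W1n.
have [m Em] := sl2_nilpotent EHG.
have [t] := pencil_rank cap0 full E0 E1 s0 s1 inj (nilpotent_ker Em E1 W1n).
rewrite -linearZ -linearD ltnNge /= => /negP[].
by apply: (principal_slice _ _).1; rewrite ?memvZ // brZr fs scaler0.
Qed.

(** [f, s] has weight -2 and is killed by e, so it vanishes and e + s is in the slice. On the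
    Fitting component W1 of ad s, a vector killed by ad (e + s) would see ad s act as - ad e,
    nilpotently; so W1 = 0. Then e + s is a sum of commuting nilpotents, and rigidity gives s =
    0. *)
Lemma zero_weight_centralizer s : s \in p -> br h s = 0 -> br e s = 0 -> s = 0.
Proof.
move=> sp hs es; have [he hf ef] := ehf.
have fs : br f s = 0.
  apply/eqP; apply: contraT => fs0.
  have E0 : E (br f s) = 0 by rewrite adE br_der ef es hs br0r addr0.
  have Hfs : H (br f s) = - 2 *: br f s.
    by rewrite adE br_der hf hs br0r addr0 brNl brZl scaleNr.
  have [i /eqP] := highest_weight_nat EHG E0 Hfs fs0.
  by rewrite eq_sym -addr_eq0 -natrD pnatr_eq0 addn2.
have sEC v : ad br s (E v) = E (ad br s v).
  by rewrite !adE br_der (brC br s e) es oppr0 br0l add0r.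
have [m [W0 [W1 [cap0 full W0P W1P]]]] := fitting (ad br s).
have iterE j v : iter j (ad br s) (E v) = E (iter j (ad br s) v).
  by elim: j => //= j ->.
have W10 : W1 = 0%VS.
  apply: (principal_no_pencil sp fs cap0 full).
  - apply/subvP => _ /memv_imgP[v /W0P[j vj] ->]; apply/W0P; exists j.
    by rewrite iterE vj linear0.
  - apply/subvP => _ /memv_imgP[v /W1P[w ->] ->]; apply/W1P; exists (E w).
    by rewrite iterE.
  - apply/subvP => _ /memv_imgP[v /W0P[j vj] ->]; apply/W0P; exists j.
    by rewrite -iterSr /= vj linear0.
  - apply/subvP => _ /memv_imgP[v /W1P[w ->] ->]; apply/W1P; exists (ad br s w).
    by rewrite -iterSr.
  apply/eqP; rewrite -subv0 -cap0; apply/subvP => v; rewrite !memv_cap memv_ker add_lfunE.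
  case/andP=> vW1; rewrite vW1 andbT addrC addr_eq0 => /eqP sv.
  have [n En] := sl2_nilpotent EHG; apply/W0P; exists n.
  have -> : iter n (ad br s) v = (- 1) ^+ n *: iter n E v; last by rewrite En scaler0.
  elim: n {En} => [|n IH]; first by rewrite scale1r.
  have EsC j w : ad br s (iter j E w) = iter j E (ad br s w).
    by elim: j => //= j <-; rewrite sEC.
  by rewrite [LHS]/= IH lfZ EsC sv linearN /= -iterSr exprS mulN1r scaleNr scalerN.
have sm v : iter m (ad br s) v = 0.
  by apply/eqP; rewrite -memv0 -W10; apply/W1P; exists v.
have [n /f2mx_expr0 En] := sl2_nilpotent EHG; move/f2mx_expr0: sm => sm.
apply: (principal_slice sp fs).2; exists (n + m)%N => v; rewrite -iter_ad.
move: v; apply/f2mx_expr0; rewrite linearD linearD /=.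
have cES : GRing.comm (f2mx E) (f2mx (ad br s)).
  rewrite /GRing.comm /GRing.mul /= -!f2mx_comp; congr f2mx.
  by apply/lfunP => v; rewrite !comp_lfunE sEC.
rewrite exprDn_comm // big1 // => -[i /= ilt] _.
have [le|lt] := leqP n (n + m - i).
  by rewrite -(subnK le) exprD En mulr0 mul0r mul0rn.
have le : (m <= i)%N by lia.
by rewrite -(subnK le) exprD sm !mulr0 mul0rn.
Qed.

Lemma weight_sum_projection0 S pi (P : int -> Prop) d v :
  weight_projections H S pi -> ~ P d -> weight_sum H P v -> pi d v = 0.
Proof.
case=> _ _ _ pi0 Pd; move: v; apply: weight_sum_ind => [|x y x0 y0|c x Pc Hx].
- exact: linear0.
- by rewrite lfD x0 y0 addr0.
by apply: pi0 Hx; apply: contra_notN Pd => /eqP<-.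
Qed.

Lemma odd_weight_eq0 d v : odd_weight d -> H v = d%:~R *: v -> v = 0.
Proof.
move=> dodd Hv.
have [W1 W1P] := weight_sum_vspace H (fun d => odd_weight d).
have [W0 W0P] := weight_sum_vspace H (fun d => ~ odd_weight d).
have oddD (b c : int) : ~~ odd_weight c -> odd_weight (b + c) = odd_weight b.
  by rewrite /odd_weight; lia.
have stab (T : 'End(V)) c (P : int -> Prop) (W : {vspace V}) :
    (forall v, v \in W <-> weight_sum H P v) -> (forall d, P d -> P (d + c)) ->
    (forall d w, H w = d%:~R *: w -> H (T w) = (d + c)%:~R *: T w) -> (T @: W <= W)%VS.
  move=> WP PP HT; apply/subvP => _ /memv_imgP[w /WP ww ->].
  move: w ww; apply: weight_sum_ind => [|x y xW yW|b x Pb Hx].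
  - by rewrite linear0 mem0v.
  - by rewrite lfD memvD.
  by apply/WP; apply: (weight_sum1 (PP _ Pb)); apply: HT.
have [S [pi piP]] := weight_projections_exist EHG; have [sumS piH pi1 pi0] := piP.
have W10 : W1 = 0%VS.
  apply: (@principal_no_pencil f W0 W1 fp); first exact: bracketxx.
  - apply/eqP; rewrite -subv0; apply/subvP => w /memv_capP[/W0P w0 /W1P w1].
    rewrite [w]sumS big1 ?mem0v // => b _.
    have [bodd|beven] := boolP (odd_weight b).
      by apply: (weight_sum_projection0 piP _ w0) => /(_ bodd).
    by apply: (weight_sum_projection0 piP _ w1); apply/negP.
  - apply/eqP; rewrite eqEsubv subvf; apply/subvP => w _.
    move: w (weight_sum_all EHG w); apply: weight_sum_ind => [|x y|c x _ Hx].
    + by rewrite mem0v.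
    + exact: memvD.
    have [codd|ceven] := boolP (odd_weight c).
      by apply: (subvP (addvSr _ _)); apply/W1P; apply: weight_sum1 Hx.
    by apply: (subvP (addvSl _ _)); apply/W0P; apply: weight_sum1 Hx; apply/negP.
  - by apply: (stab _ 2 _ _ W0P) (weight_Ez EHG) => b; rewrite oddD.
  - by apply: (stab _ 2 _ _ W1P) (weight_Ez EHG) => b; rewrite oddD.
  - by apply: (stab _ (-2) _ _ W0P) (weight_Gz EHG) => b; rewrite oddD.
  - by apply: (stab _ (-2) _ _ W1P) (weight_Gz EHG) => b; rewrite oddD.
  apply/eqP; rewrite -subv0; apply/subvP => w /memv_capP[/W1P w1].
  rewrite memv_ker add_lfunE => /eqP EG.
  by rewrite (sl2_odd_injective EHG w1 EG) mem0v.
by apply/eqP; rewrite -memv0 -W10; apply/W1P; apply: weight_sum1 Hv.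
Qed.

Lemma positive_partP u : is_positive_part br h u ->
  forall v, v \in u <-> weight_sum H (fun d => 0 < d) v.
Proof.
case=> gu umin v; split=> [|uv].
  have [U UP] := weight_sum_vspace H (fun d => 0 < d) => /(subvP (umin U _)) uU.
  apply/UP/uU => d d0; apply/subvP => w; rewrite mem_leigenspace => /eqP Hw.
  by apply/UP; apply: weight_sum1 Hw.
move: v uv; apply: weight_sum_ind => [|x y|d x d0 Hx]; first exact: mem0v.
  exact: memvD.
by apply: (subvP (gu d d0)); rewrite mem_leigenspace Hx.
Qed.

(** Without odd weights, two positive weights add up to at least 4. Conversely a vector of weight d
    >= 4 is [e, w] with w of weight d - 2 > 0, and e itself has weight 2. *)
Lemma positive_derivedP u : is_positive_part br h u ->
  forall v, v \in lie_prod br u u <-> weight_sum H (fun d => 4 <= d) v.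
Proof.
move=> upos v; have uP := positive_partP upos; split=> [|vD].
  have [U UP] := weight_sum_vspace H (fun d => 4 <= d).
  have uU : (lie_prod br u u <= U)%VS.
    apply/lie_prodP => x y /uP ux /uP uy.
    move: x ux; apply: weight_sum_ind => [|x x' xU x'U|c x c0 Hx].
    - by rewrite br0l mem0v.
    - by rewrite brDl memvD.
    move: y uy; apply: weight_sum_ind => [|y y' yU y'U|d y d0 Hy].
    - by rewrite br0r mem0v.
    - by rewrite brDr memvD.
    have [codd|ceven] := boolP (odd_weight c).
      by rewrite (odd_weight_eq0 codd Hx) br0l mem0v.
    have [dodd|deven] := boolP (odd_weight d).
      by rewrite (odd_weight_eq0 dodd Hy) br0r mem0v.
    apply/UP; apply: (@weight_sum1 _ _ _ _ (c + d)).
      by move: ceven deven; rewrite /odd_weight; lia.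
    move: Hx Hy; rewrite !adE br_der => -> ->.
    by rewrite brZl brZr -scalerDl intrD.
  by move/(subvP uU)/UP.
move: v vD; apply: weight_sum_ind => [|x y|d x d4 Hx]; first exact: mem0v.
  exact: memvD.
have [|w Hw ->] := sl2_surj EHG _ Hx; first by lia.
rewrite adE; apply: (lie_prodP br u u _).2 (subvv _) _ _ _ _; apply/uP.
  by apply: (@weight_sum1 _ _ _ _ 2) => //; rewrite adE; case: ehf.
by apply: weight_sum1 Hw; lia.
Qed.

Lemma positive_even_dim u : is_positive_part br h u ->
  dim_quotient (plus_part theta u) (plus_part theta (lie_prod br u u)) =
  \dim (weight_space br h 2 :&: k).
Proof.
move=> upos; have uP := positive_partP upos; have DP := positive_derivedP upos.
have [S [pi piP]] := weight_projections_exist EHG; have [_ piH pi1 pi0] := piP.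
rewrite /dim_quotient /plus_part; set D := lie_prod br u u.
have Du : (D <= u)%VS.
  apply/subvP => v /DP; move: v; apply: weight_sum_ind => [|x y|d x d4 Hx].
  - exact: mem0v.
  - exact: memvD.
  by apply/uP; apply: weight_sum1 Hx; lia.
have split2 v : v \in u -> v - pi 2 v \in D.
  move=> /uP; move: v; apply: weight_sum_ind => [|x y xD yD|d x d0 Hx].
  - by rewrite linear0 subr0 mem0v.
  - by rewrite lfD opprD addrACA memvD.
  have [d2|d2] := eqVneq d 2.
    by rewrite (pi1 2 x) ?subrr ?mem0v // -d2.
  rewrite (pi0 2 d) // subr0; apply/DP.
  have [dodd|deven] := boolP (odd_weight d).
    by rewrite (odd_weight_eq0 dodd Hx); exists [::]; rewrite ?big_nil.
  by apply: weight_sum1 Hx; move: deven; rewrite /odd_weight; lia.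
have uE : (u :&: k = (D :&: k) + (weight_space br h 2 :&: k))%VS.
  apply/eqP; rewrite eqEsubv subv_add capvS //= andbC; apply/andP; split.
    rewrite capvS //; case: upos => gu _; exact: gu.
  apply/subvP => v /memv_capP[vu /even_spaceP vk].
  have pk : pi 2 v \in k by apply/even_spaceP; rewrite -(weight_projection_theta _ _ piP) vk.
  rewrite -(subrK (pi 2 v) v) memv_add // memv_cap ?pk ?split2 ?memvB //; last first.
    by rewrite andbT mem_leigenspace piH.
  by apply/even_spaceP.
have cap0 : ((D :&: k) :&: (weight_space br h 2 :&: k) = 0)%VS.
  apply/eqP; rewrite -subv0; apply/subvP => v /memv_capP[/memv_capP[/DP vD _] /memv_capP[]].
  rewrite mem_leigenspace => /eqP Hv _.
  by rewrite memv0 -(pi1 2 v Hv) (weight_sum_projection0 piP _ vD).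
have := dimv_cap_compl (u :&: k) (D :&: k).
have -> : ((u :&: k) :&: (D :&: k) = D :&: k)%VS by apply/capv_idPr; rewrite capvS.
by rewrite {2}uE (dimv_disjoint_sum cap0) => /eqP; rewrite eqn_add2l => /eqP.
Qed.

(** For surjectivity, [sl2_surj] gives a preimage in weight 0, and its odd part already suffices
    since ad e exchanges k and p. *)
Lemma zero_weight_odd_dim :
  \dim (weight_space br h 0 :&: p) = \dim (weight_space br h 2 :&: k).
Proof.
have cap0 : ((weight_space br h 0 :&: p) :&: lker E = 0)%VS.
  apply/eqP; rewrite -subv0; apply/subvP => v /memv_capP[/memv_capP[]].
  rewrite mem_leigenspace memv_ker scale0r !adE => /eqP hv vp /eqP ev.
  by rewrite (zero_weight_centralizer vp hv ev) mem0v.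
rewrite -(limg_dim_eq cap0); congr (\dim _); apply/eqP; rewrite eqEsubv.
apply/andP; split; apply/subvP => v.
  case/memv_imgP=> w /memv_capP[]; rewrite mem_leigenspace => /eqP Hw wp ->.
  by rewrite memv_cap mem_leigenspace (weight_Ez EHG Hw) add0r eqxx adE br_odd_odd.
rewrite memv_cap mem_leigenspace => /andP[/eqP Hv vk].
have [//|w Hw vE] := sl2_surj EHG _ Hv; have [wk wp wE] := even_odd_parts thetaP w.
rewrite subrr in Hw; set x := _ *: _ in wk wE; set y := _ *: _ in wp wE.
have xp : E x \in p by rewrite adE br_odd_even.
have yk : E y \in k by rewrite adE br_odd_odd.
have vxy : v = E x + E y by rewrite vE {1}wE lfD.
have -> : v = E y.
  apply/eqP; rewrite -subr_eq0 -memv0 -(even_odd_direct theta) memv_cap memvB //.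
  by rewrite vxy addrK.
apply: memv_img; rewrite memv_cap wp andbT mem_leigenspace.
by rewrite /y lfZ lfD lfN (weight_theta Hw) Hw !scale0r subrr scaler0.
Qed.

End PrincipalTriple.

Lemma complex_uncountable (R : realType) : ~ countable [set: R[i]].
Proof.
case/countable_injP => c /in2TT cinj; apply: (@reals_uncountable R).
apply/countable_injP; exists (fun x : R => c x%:C)%C => x y _ _ /cinj.
by case.
Qed.

Theorem theorem8 (R : realType) (g : vectType R[i]) (br : lie_bracket g)
    (theta : 'End(g)) (K : set 'End(g)) (e h f : g) (u : {vspace g}) :
  semisimple br ->
  lie_involution br theta ->
  connected_subgroup_with_lie_algebra br (even_space theta) K ->
  principal_nilpotents br theta K e ->
  sl2_triple br e h f ->
  h \in even_space theta ->
  e \in odd_space theta ->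
  f \in odd_space theta ->
  is_positive_part br h u ->
  \dim (minus_part theta (weight_space br h 0)) =
    dim_quotient (plus_part theta u) (plus_part theta (lie_prod br u u)).
Proof.
move=> ss thetaP Kk eprin ehf hk ep fp upos.
have [q [qe qP]] := principal_open Kk eprin.
have Func := @complex_uncountable R.
rewrite (positive_even_dim ss thetaP ehf hk ep fp qe qP Func upos).
exact: (zero_weight_odd_dim ss thetaP ehf hk ep fp qe qP Func).
Qed.
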